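(* Let $d\ge 1$ and $n\ge 1$ be integers, $t=d+n$, and let ${\mathbb X}\subseteq{\mathbb P}^2$ be a set of $\binom{d+1}{2}$ distinct points in generic position. Let $I_t$ be the degree-$t$ component of the homogeneous ideal $I_{\mathbb X}\subseteq R=\mathfrak{k}[w_1,w_2,w_3]$, and let $\overline{\Lambda_t}\subseteq{\mathbb P}^p$, $p=\binom{n+2}{2}(d+1)-1$, be the embedding of the blowup ${\mathbb P}^2({\mathbb X})$ of ${\mathbb P}^2$ at ${\mathbb X}$ given by the linear system $I_t$, namely the closure of the image of the rational map ${\mathbb P}^2 - - \rightarrow {\mathbb P}^p$, $[w_1:w_2:w_3]\mapsto [z_iF_j]_{1\le i\le u,\,1\le j\le d+1}$. Then the subscheme $\overline{\Lambda_t}$ of ${\mathbb P}^p$ is defined by $\binom{n+1}{2}d$ linear forms together with the $2\times 2$ minors of a box-shaped matrix of linear forms.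
   Context: $\mathfrak{k}$ is algebraically closed of characteristic $0$. ''Generic position'' means the Hilbert function of ${\mathbb X}$ is maximal: $\dim_{\mathfrak{k}}(R/I_{\mathbb X})_s=\min\{\binom{s+2}{2},|{\mathbb X}|\}$ for all $s$; then $I_{\mathbb X}=\bigoplus_{s\ge d}I_s$ is generated by $I_d$, and its minimal generators $F_1,\dots,F_{d+1}$ are the signed maximal minors $F_j=(-1)^{j+1}\det({\bf L}\setminus j\text{-th column})$ of a $d\times(d+1)$ matrix ${\bf L}$ of linear forms. Here $u=\binom{n+2}{2}$ and $z_1=w_1^n,z_2=w_1^{n-1}w_2,\dots,z_u=w_3^n$ are the degree-$n$ monomials in lexicographic order ($w_1>w_2>w_3$); the homogeneous coordinates of ${\mathbb P}^p$ are $x_{ij}$ ($1\le i\le u$, $1\le j\le d+1$). A box-shaped matrix of size $r_1\times\cdots\times r_m$ is an array $(a_{i_1\ldots i_m})$ indexed by $\{(i_1,\dots,i_m):1\le i_k\le r_k\}$; its $2\times2$ minors are the elements $a_{i_1\ldots i_l\ldots i_m}a_{j_1\ldots j_l\ldots j_m}-a_{i_1\ldots i_{l-1}j_li_{l+1}\ldots i_m}a_{j_1\ldots j_{l-1}i_lj_{l+1}\ldots j_m}$ for any coordinate $l$ and any two index points. *)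

(* Defs.v *)
From HB Require Import structures.
From mathcomp Require Import all_boot all_order all_algebra.
From mathcomp Require Import mpoly.
Set Implicit Arguments. Unset Strict Implicit. Unset Printing Implicit Defensive.
Import Order.TTheory GRing.Theory.
Local Open Scope ring_scope.

(* Exponent triples (e1,e2,e3) of the degree-s monomials w1^e1 w2^e2 w3^e3,
   listed in lexicographic order with w1 > w2 > w3.  Its size is 'C(s.+2,2). *)
Definition lex_exps (s : nat) : seq (nat * nat * nat) :=
  [seq ((s - a)%N, (a - b)%N, b) | a <- iota 0 s.+1, b <- iota 0 a.+1].

Definition lexmon (k : nzRingType) (s i : nat) : {mpoly k[3]} :=
  let e := nth (0%N, 0%N, 0%N) (lex_exps s) i in
  'X_(0 : 'I_3) ^+ e.1.1 * 'X_(1 : 'I_3) ^+ e.1.2 * 'X_(2 : 'I_3) ^+ e.2.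

Definition coords (k : nzRingType) (P : 'rV[k]_3) : 'I_3 -> k := fun i => P 0 i.

Definition distinct_proj_points (k : fieldType) (N : nat) (P : 'I_N -> 'rV[k]_3) :=
  (forall a, P a != 0) /\
  (forall a b, a != b -> ~ exists c : k, P a = c *: P b).

(* Evaluation matrix of the degree-s monomials at the points:
   its rank is dim_k (R / I_X)_s  (since I_s is exactly the kernel of
   evaluation R_s -> k^N). *)
Definition eval_mx (k : fieldType) (N : nat) (P : 'I_N -> 'rV[k]_3) (s : nat)
  : 'M[k]_('C(s.+2, 2), N) :=
  \matrix_(i, b) (lexmon k s i).@[coords (P b)].

Definition hilb_fun (k : fieldType) (N : nat) (P : 'I_N -> 'rV[k]_3) (s : nat) : nat :=
  \rank (eval_mx P s).

Definition generic_position (k : fieldType) (N : nat) (P : 'I_N -> 'rV[k]_3) :=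
  forall s : nat, hilb_fun P s = minn 'C(s.+2, 2) N.

(* The point  [z_i F_j]_{i,j}  of the affine cone over P^p, with
   coordinate x_ij at index mxvec_index i j. *)
Definition phi (k : fieldType) (d n : nat) (F : 'I_d.+1 -> {mpoly k[3]})
  (w : 'I_3 -> k) : 'I_('C(n.+2, 2) * d.+1) -> k :=
  fun s => mxvec (\matrix_(i < 'C(n.+2, 2), j < d.+1)
                    (lexmon k n i * F j).@[w]) 0 s.
Arguments phi {k d} n F w.

(* Homogeneous ideal of the closure of the image of the rational map
   [w] |-> [z_i F_j] : the polynomials vanishing on (the cone over) the image. *)
Definition closure_ideal (k : fieldType) (d n : nat) (F : 'I_d.+1 -> {mpoly k[3]})
  (G : {mpoly k[('C(n.+2, 2) * d.+1)]}) : Prop :=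
  forall w : 'I_3 -> k, G.@[phi n F w] = 0.
Arguments closure_ideal {k d} n F G.

Definition in_ideal (k : nzRingType) (M : nat) (gens : {mpoly k[M]} -> Prop)
  (G : {mpoly k[M]}) : Prop :=
  exists cs : seq ({mpoly k[M]} * {mpoly k[M]}),
    (forall c, c \in cs -> gens c.2) /\ G = \sum_(c <- cs) c.1 * c.2.

Definition in_box (m : nat) (r : 'I_m -> nat) (i : 'I_m -> nat) : Prop :=
  forall l, (i l < r l)%N.

Definition swap_coord (m : nat) (l : 'I_m) (i j : 'I_m -> nat) : 'I_m -> nat :=
  fun l' => if l' == l then j l else i l'.

Definition box_minor (k : nzRingType) (M m : nat) (A : ('I_m -> nat) -> {mpoly k[M]})
  (l : 'I_m) (i j : 'I_m -> nat) : {mpoly k[M]} :=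
  A i * A j - A (swap_coord l i j) * A (swap_coord l j i).

Definition is_box_minor (k : nzRingType) (M m : nat) (r : 'I_m -> nat)
  (A : ('I_m -> nat) -> {mpoly k[M]}) (g : {mpoly k[M]}) : Prop :=
  exists l i j, in_box r i /\ in_box r j /\ g = box_minor A l i j.

(* The projective subscheme defined by the ideal J (given by generators)
   equals the reduced subscheme with homogeneous ideal I:  J^sat = I. *)
Definition defines_subscheme (k : nzRingType) (M : nat)
  (gens : {mpoly k[M]} -> Prop) (I : {mpoly k[M]} -> Prop) : Prop :=
  (forall G, in_ideal gens G -> I G) /\
  (forall G, I G -> exists N : nat, forall a : 'X_{1..M},
      mdeg a = N -> in_ideal gens ('X_[a] * G)).

(* Main.v *)
(* Choose a linear form ell not vanishing on X. Modulo ell the forms F_j span all binary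
   forms of degree d, since no form of degree d - 1 vanishes on X; lifting the obvious
   relations between w1^i w2^(d-i) gives d linear syzygies L of the F_j, which generate all
   syzygies freely (Hilbert-Burch).  The linear equations are the multiples of the rows of
   L by the monomials of degree n - 1, and the box has entries x_{w_b z', j}.

   Let J be the ideal they generate and let G be homogeneous of degree e in the ideal of
   the image.  On the chart h = x_{w_b^n, j0} write u_c = x_{w_b^(n-1) w_c, j0} and
   v_j = x_{w_b^n, j}: up to powers of h, x_{z,j} is z(u) v_j modulo J, and every syzygy g
   of the F_j gives sum_j g_j(u) v_j in J.  Near a point p of X let S be the form of degree
   d - 1 with value 1 at p and 0 on the rest of X, and l1, l2 two linear forms through p.
   Then l1 S and l2 S lie in I_d and generate the ideal where S is invertible; with V1, V2
   the corresponding combinations of the v_j, one gets F_j = A_j l1 + B_j l2,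
   S(u) v_j = A_j(u) V1 + B_j(u) V2 and l2(u) V1 = l1(u) V2 modulo J.  This parametrizes
   the chart V1 <> 0 by polynomials on which G vanishes identically, so a power of
   h S(u) V1, and likewise of h S(u) V2, multiplies G into J.  As the S span the forms of
   degree d - 1, a power of each coordinate multiplies G into J. *)

Require Import Defs.
From HB Require Import structures.
From mathcomp Require Import all_boot all_order all_algebra.
From mathcomp Require Import ring zify.
From mathcomp Require Import mpoly.
Import Order.TTheory GRing.Theory.
Set Implicit Arguments. Unset Strict Implicit. Unset Printing Implicit Defensive.
Local Open Scope ring_scope.

Local Notation subst t := (comp_mpoly (mktuple t)).

(** * Substitutions and ideals *)

Section Substitution.
Variable k : fieldType.

Lemma substXU a b (t : 'I_a -> {mpoly k[b]}) i : subst t 'X_i = t i.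
Proof. by rewrite comp_mpolyXU -tnth_nth tnth_mktuple. Qed.

Lemma substX a b (t : 'I_a -> {mpoly k[b]}) m :
  subst t 'X_[m] = \prod_i t i ^+ m i.
Proof. by rewrite comp_mpolyX; apply: eq_bigr => i _; rewrite tnth_mktuple. Qed.

Lemma eq_subst a b (t t' : 'I_a -> {mpoly k[b]}) p :
  t =1 t' -> subst t p = subst t' p.
Proof. by move=> h; rewrite (eq_mktuple _ h). Qed.

Lemma substE a b (t : 'I_a -> {mpoly k[b]}) p :
  subst t p = \sum_(m <- msupp p) p@_m *: \prod_i t i ^+ m i.
Proof.
by rewrite {1}[p]mpolyE raddf_sum; apply: eq_bigr => m _; rewrite /= comp_mpolyZ substX.
Qed.

Lemma subst_id a (p : {mpoly k[a]}) : subst (fun i => 'X_i) p = p.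
Proof. exact: comp_mpoly_id. Qed.

Lemma subst_subst a b c (t : 'I_b -> {mpoly k[c]}) (s : 'I_a -> {mpoly k[b]}) p :
  subst t (subst s p) = subst (fun i => subst t (s i)) p.
Proof.
rewrite (substE s) [RHS]substE raddf_sum; apply: eq_bigr => m _; rewrite /= comp_mpolyZ rmorph_prod.
by congr (_ *: _); apply: eq_bigr => i _; rewrite rmorphXn.
Qed.

Lemma meval_subst a b (t : 'I_a -> {mpoly k[b]}) p v :
  (subst t p).@[v] = p.@[fun i => (t i).@[v]].
Proof.
rewrite substE [RHS]mevalE raddf_sum; apply: eq_bigr => m _; rewrite /= mevalZ rmorph_prod.
by congr (_ * _); apply: eq_bigr => i _; rewrite rmorphXn.
Qed.

Lemma subst_homog a b (t : 'I_a -> {mpoly k[b]}) p e D :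
  (forall i, t i \is D.-homog) -> p \is e.-homog -> subst t p \is (D * e).-homog.
Proof.
move=> ht /dhomogP hp; rewrite substE big_seq.
apply: rpred_sum => m /hp hm; apply: rpredZ.
rewrite -(hm : mdeg m = e) mdegE big_distrr /=.
apply: (big_ind2 (fun (x : {mpoly k[b]}) y => x \is y.-homog)).
- exact: dhomog1.
- by move=> x1 y1 x2 y2 h1 h2; apply: dhomogM.
by move=> i _; apply: dhomogMn.
Qed.

Lemma subst_scale a b (t : 'I_a -> {mpoly k[b]}) c p e :
  p \is e.-homog -> subst (fun i => c * t i) p = c ^+ e * subst t p.
Proof.
move=> /dhomogP hp; rewrite !substE mulr_sumr big_seq [RHS]big_seq.
apply: eq_bigr => m /hp hm; rewrite -scalerAr; congr (_ *: _).
have -> : c ^+ e = \prod_(i < a) c ^+ m i.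
  by rewrite -(hm : mdeg m = e) mdegE (big_morph _ (exprD c) (expr0 c)).
by rewrite -big_split /=; apply: eq_bigr => i _; rewrite exprMn.
Qed.

Lemma meval_scale a (v : 'I_a -> k) c p e :
  p \is e.-homog -> p.@[fun i => c * v i] = c ^+ e * p.@[v].
Proof.
move=> /dhomogP hp; rewrite !mevalE mulr_sumr big_seq [RHS]big_seq.
apply: eq_bigr => m /hp hm; rewrite mulrCA; congr (_ * _).
have -> : c ^+ e = \prod_(i < a) c ^+ m i.
  by rewrite -(hm : mdeg m = e) mdegE (big_morph _ (exprD c) (expr0 c)).
by rewrite -big_split /=; apply: eq_bigr => i _; rewrite exprMn.
Qed.

(** In characteristic 0 the integers below [size q] are distinct in k, and they outnumber the
    possible roots of q. *)
Lemma exists_nonroot (hchar : [pchar k] =i pred0) (q : {poly k}) :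
  q != 0 -> exists t, q.[t] != 0.
Proof.
move=> q0; pose s : seq k := [seq i%:R | i <- iota 0 (size q)].
case: (boolP (all (root q) s)) => [hs|/allPn[t _ ht]]; last by exists t.
suff us : uniq s by have := max_poly_roots q0 hs us; rewrite size_map size_iota ltnn.
rewrite map_inj_uniq ?iota_uniq //.
suff wl : forall x y, (x <= y)%N -> x%:R = y%:R :> k -> x = y.
  move=> x y; case/orP: (leq_total x y) => h e; first exact: wl.
  by apply/esym/wl.
move=> x y h /eqP; rewrite eq_sym -subr_eq0 -natrB //.
by rewrite ((pcharf0P k).1 hchar) subn_eq0 => h'; apply/eqP; rewrite eqn_leq h.
Qed.

(* Kronecker substitution ['X_i := t ^ (B ^ i)] is injective on the monomials of degree < B. *)
Lemma meval_eq0 (hchar : [pchar k] =i pred0) a (p : {mpoly k[a]}) :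
  (forall v, p.@[v] = 0) -> p = 0.
Proof.
move=> hp; set B := (msize p).+1.
pose enc (m : 'X_{1..a}) := (\sum_i m i * B ^ i)%N.
have enc_inj : {in msupp p &, injective enc}.
  (* Uniqueness of base-[B] expansions, reading off the lowest digit modulo [B]. *)
  have digits : forall b (f g : 'I_b -> nat), (forall i, f i < B)%N ->
      (forall i, g i < B)%N -> (\sum_i f i * B ^ i = \sum_i g i * B ^ i)%N -> f =1 g.
    elim=> [|b IH] f g hf hg; first by move=> _ [].
    rewrite !big_ord_recl /= !expn0 !muln1.
    have E (h : 'I_b.+1 -> nat) : (\sum_(i < b) h (lift ord0 i) * B ^ bump 0 i =
        B * \sum_(i < b) h (lift ord0 i) * B ^ i)%N.
      by rewrite big_distrr; apply: eq_bigr => i _; rewrite /= expnS mulnCA.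
    rewrite !E => eqfg.
    have h0 : f ord0 = g ord0.
      have := congr1 (modn^~ B) eqfg.
      by rewrite ![(_ + B * _)%N]addnC ![(B * _)%N]mulnC !modnMDl !modn_small.
    move: eqfg; rewrite h0 => /addnI /eqP; rewrite eqn_pmul2l // => /eqP eqfg.
    move=> i; case: (unliftP ord0 i) => [j ->|->] //.
    exact: (IH (fun j => f (lift ord0 j)) (fun j => g (lift ord0 j))).
  move=> m1 m2 h1 h2 heq; apply/mnmP; apply: digits heq => i.
    by rewrite ltnS; apply: leq_trans (ltnW (msize_mdeg_lt h1)); rewrite mdegE (bigD1 i) //= leq_addr.
  by rewrite ltnS; apply: leq_trans (ltnW (msize_mdeg_lt h2)); rewrite mdegE (bigD1 i) //= leq_addr.
(* The value of [q] at t is that of [p] at (t, t^B, t^(B^2), ...), so [q] vanishes everywhere. *)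
pose q : {poly k} := \sum_(m <- msupp p) p@_m *: 'X^(enc m).
have q0 : q = 0.
  apply/eqP; apply/negPn/negP => /(exists_nonroot hchar)[t /eqP[]].
  rewrite -(hp (fun i => t ^+ (B ^ i)%N)) mevalE.
  rewrite /q horner_sum; apply: eq_bigr => m _.
  rewrite hornerZ hornerXn; congr (_ * _).
  rewrite (big_morph _ (exprD t) (expr0 t)); apply: eq_bigr => i _.
  by rewrite -exprM mulnC.
apply/mpolyP => m; rewrite mcoeff0.
case: (boolP (m \in msupp p)) => [hm|]; last by move/memN_msupp_eq0.
have := congr1 (fun r : {poly k} => r`_(enc m)) q0; rewrite coef0 coef_sum => <-.
rewrite (bigD1_seq m) //= coefZ coefXn eqxx mulr1 big1_seq ?addr0 // => m'.
case/andP=> ne hm'; rewrite coefZ coefXn.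
case: eqP => [e|]; last by rewrite mulr0.
by rewrite (enc_inj _ _ hm hm' e) eqxx in ne.
Qed.

End Substitution.

(** * Ideals, congruences and radicals of ideal quotients *)

Section Ideals.
Variable R : comNzRingType.

(** Ideals are predicates, so that one congruence calculus serves [in_ideal], [mod_ideal] and ideals
    introduced inside a proof. *)
Definition is_ideal (I : R -> Prop) :=
  [/\ I 0, forall a b, I a -> I b -> I (a + b) & forall a b, I b -> I (a * b)].

Variables (I : R -> Prop) (hI : is_ideal I).

Lemma ideal_sum T (s : seq T) (P : pred T) f :
  (forall i, P i -> I (f i)) -> I (\sum_(i <- s | P i) f i).
Proof. by move=> h; case: hI => ? ? _; elim/big_ind: _. Qed.

Lemma ideal_opp a : I a -> I (- a).
Proof. by rewrite -mulN1r; case: hI => _ _; apply. Qed.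

(** Congruence of a and b modulo [I] is written [I (a - b)]; it is compatible with all ring
    operations. *)
Lemma ideal_congr_refl a : I (a - a).
Proof. by rewrite subrr; case: hI. Qed.

Lemma ideal_congr_sym a b : I (a - b) -> I (b - a).
Proof. by move/ideal_opp; rewrite opprB. Qed.

Lemma ideal_congr_trans b a c : I (a - b) -> I (b - c) -> I (a - c).
Proof.
move=> h1 h2; have -> : a - c = (a - b) + (b - c) by ring.
by case: hI => _ + _; apply.
Qed.

Lemma ideal_congr_mem a b : I (a - b) -> I b -> I a.
Proof.
move=> h1 h2; have -> : a = (a - b) + b by ring.
by case: hI => _ + _; apply.
Qed.

Lemma ideal_congr_mull c a b : I (a - b) -> I (c * a - c * b).
Proof. by rewrite -mulrBr; case: hI => _ _; apply. Qed.

Lemma ideal_congr_mul a b a' b' :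
  I (a - a') -> I (b - b') -> I (a * b - a' * b').
Proof.
move=> h1 h2; have -> : a * b - a' * b' = b * (a - a') + a' * (b - b') by ring.
by case: hI => _ hD hM; apply: hD; apply: hM.
Qed.

Lemma ideal_congr_add a b a' b' :
  I (a - a') -> I (b - b') -> I (a + b - (a' + b')).
Proof.
move=> h1 h2; have -> : a + b - (a' + b') = (a - a') + (b - b') by ring.
by case: hI => _ hD _; apply: hD.
Qed.

Lemma ideal_congr_sum T (s : seq T) (f g : T -> R) :
  (forall i, I (f i - g i)) -> I (\sum_(i <- s) f i - \sum_(i <- s) g i).
Proof. by move=> h; rewrite -sumrB; apply: ideal_sum. Qed.

Lemma ideal_congr_exp e a a' : I (a - a') -> I (a ^+ e - a' ^+ e).
Proof.
move=> h; elim: e => [|e IH]; first by rewrite !expr0; apply: ideal_congr_refl.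
by rewrite !exprS; apply: ideal_congr_mul.
Qed.

Lemma ideal_congr_prod T (s : seq T) (f g : T -> R) :
  (forall i, I (f i - g i)) -> I (\prod_(i <- s) f i - \prod_(i <- s) g i).
Proof.
move=> h; elim: s => [|x s IH]; first by rewrite !big_nil; apply: ideal_congr_refl.
by rewrite !big_cons; apply: ideal_congr_mul.
Qed.

(* [rad_colon G] is the radical of the ideal quotient (I : G). *)
Definition rad_colon (G f : R) := exists e, I (f ^+ e * G).

Lemma rad_colon_congr G f g : I (f - g) -> rad_colon G g -> rad_colon G f.
Proof.
move=> hfg [e he]; exists e; apply: ideal_congr_mem he.
by apply: ideal_congr_mul; [apply: ideal_congr_exp|apply: ideal_congr_refl].
Qed.

Lemma rad_colon_mull G a f : rad_colon G f -> rad_colon G (a * f).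
Proof.
by case=> e he; exists e; rewrite exprMn -mulrA; case: hI => _ _; apply.
Qed.

Lemma rad_colon_exp G e f : rad_colon G (f ^+ e) -> rad_colon G f.
Proof. by case=> e' he; exists (e * e')%N; rewrite exprM. Qed.

(** In each term of the binomial expansion of (f + g)^(e + e'), the exponent of g is at least e' or
    that of f is at least e. *)
Lemma rad_colon_add G f g : rad_colon G f -> rad_colon G g -> rad_colon G (f + g).
Proof.
case: (hI) => _ _ hM [e he] [e' he']; exists (e + e')%N.
rewrite exprDn mulr_suml; apply: ideal_sum => i _; rewrite mulrnAl -mulr_natl; apply: (hM).
case: (leqP e' i) => hi.
  rewrite -{2}(subnK hi) exprD.
  have -> x y z : x * (y * z) * G = (x * y) * (z * G) by ring.
  exact: (hM).
have h : (e <= e + e' - i)%N by lia.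
rewrite -(subnK h) exprD.
have -> x y z : x * y * z * G = (x * z) * (y * G) by ring.
exact: (hM).
Qed.

Lemma rad_colon_sum G T (s : seq T) f : (forall i, rad_colon G (f i)) ->
  rad_colon G (\sum_(i <- s) f i).
Proof.
move=> h; elim/big_ind: _ => //; last exact: rad_colon_add.
by exists 1%N; rewrite expr1 mul0r; case: hI.
Qed.

End Ideals.

(** Applied with the variables themselves as [t], this yields divisibility by linear forms without a
    division algorithm. *)
Lemma subst_congr (k : fieldType) a b (I : {mpoly k[b]} -> Prop)
    (t t' : 'I_a -> {mpoly k[b]}) p :
  is_ideal I -> (forall i, I (t i - t' i)) -> I (subst t p - subst t' p).
Proof.
move=> hI h; rewrite !substE; apply: ideal_congr_sum => // m.
rewrite -!mul_mpolyC; apply: ideal_congr_mull => //.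
by apply: ideal_congr_prod => // i; apply: ideal_congr_exp.
Qed.

Lemma in_ideal_is_ideal (k : fieldType) M (gens : {mpoly k[M]} -> Prop) :
  is_ideal (in_ideal gens).
Proof.
split.
- by exists [::]; rewrite big_nil.
- move=> a b [s1 [h1 ->]] [s2 [h2 ->]]; exists (s1 ++ s2); rewrite big_cat; split=> //.
  by move=> c; rewrite mem_cat => /orP[/h1|/h2].
move=> a b [s [h ->]]; exists [seq (a * c.1, c.2) | c <- s]; split.
  by move=> c /mapP[c' /h hc' ->].
by rewrite big_map mulr_sumr; apply: eq_bigr => c _; rewrite mulrA.
Qed.

Lemma in_ideal_gen (k : fieldType) M (gens : {mpoly k[M]} -> Prop) g :
  gens g -> in_ideal gens g.
Proof.
by move=> h; exists [:: (1, g)]; split=> [c|]; rewrite ?inE ?big_seq1 ?mul1r // => /eqP->.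
Qed.

(** * Ternary monomials in lexicographic order *)

Lemma prod_ord3 (R : pzSemiRingType) (f : 'I_3 -> R) : \prod_i f i = f 0 * f 1 * f 2.
Proof.
rewrite !big_ord_recl big_ord0 mulr1 mulrA.
by congr (f _ * f _ * f _); apply/val_inj.
Qed.

Lemma ord3P (P : 'I_3 -> Prop) : P 0 -> P 1 -> P 2 -> forall i, P i.
Proof.
move=> h0 h1 h2 [[|[|[|//]]] hi].
- by have -> : Ordinal hi = 0 by apply/val_inj.
- by have -> : Ordinal hi = 1 by apply/val_inj.
by have -> : Ordinal hi = 2 by apply/val_inj.
Qed.

Lemma mdeg3 (m : 'X_{1..3}) : mdeg m = (m 0%R + m 1%R + m 2%R)%N.
Proof.
rewrite mdegE !big_ord_recl big_ord0 addn0 addnA.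
by congr (m _ + m _ + m _)%N; apply/val_inj.
Qed.

Definition lexmnm (s i : nat) : 'X_{1..3} :=
  let e := nth (0%N, 0%N, 0%N) (lex_exps s) i in
  [multinom nth 0%N [:: e.1.1; e.1.2; e.2] (c : 'I_3) | c < 3].

Lemma lexmonE (k : fieldType) s i : lexmon k s i = 'X_[lexmnm s i].
Proof. by rewrite /lexmon /lexmnm [RHS]mpolyXE_id prod_ord3 !mnmE. Qed.

Lemma size_lex_exps s : size (lex_exps s) = 'C(s.+2, 2).
Proof.
rewrite /lex_exps size_allpairs_dep -bin2_sum.
under eq_map do rewrite size_iota.
rewrite sumnE big_map -/(index_iota 0 s.+1) [RHS]big_nat_recl // add0n.
Qed.

Lemma mem_lex_exps s e1 e2 e3 :
  ((e1, e2, e3) \in lex_exps s) = (e1 + e2 + e3 == s)%N.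
Proof.
apply/allpairsPdep/eqP => [[a [b]]|<-].
  by rewrite !mem_iota => -[ha hb [-> -> ->]]; lia.
exists (e2 + e3)%N, e3; rewrite !mem_iota; split; try lia.
by congr (_, _, _); lia.
Qed.

Lemma uniq_lex_exps s : uniq (lex_exps s).
Proof.
apply: allpairs_uniq_dep => [|a _|]; rewrite ?iota_uniq //.
move=> p q /allpairsPdep[x [y [hx hy ->]]] /allpairsPdep[x' [y' [hx' hy' ->]]] /=.
move: hx hx' hy hy'; rewrite !mem_iota => hx hx' hy hy' [h1 h2 h3].
by subst y'; have -> : x = x' by lia.
Qed.

Lemma lexmnm_deg s i : (i < 'C(s.+2, 2))%N -> mdeg (lexmnm s i) = s.
Proof.
rewrite -size_lex_exps => hi; rewrite mdeg3 !mnmE /=.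
have := mem_nth (0%N, 0%N, 0%N) hi.
by case: (nth _ _ _) => [[e1 e2] e3] /=; rewrite mem_lex_exps => /eqP.
Qed.

Lemma lexmnm_surj s m : mdeg m = s -> exists i : 'I_('C(s.+2, 2)), lexmnm s i = m.
Proof.
rewrite mdeg3 => /eqP; rewrite -mem_lex_exps => hm.
have hi : (index (m 0%R, m 1%R, m 2%R) (lex_exps s) < 'C(s.+2, 2))%N.
  by rewrite -size_lex_exps index_mem.
exists (Ordinal hi); apply/mnmP; rewrite /lexmnm nth_index //.
by apply: ord3P; rewrite mnmE.
Qed.

Lemma lexmnm_inj s (i j : 'I_('C(s.+2, 2))) : lexmnm s i = lexmnm s j -> i = j.
Proof.
move=> /mnmP h; apply/val_inj/eqP.
rewrite /= -(nth_uniq (0, 0, 0)%N _ _ (uniq_lex_exps s)) ?size_lex_exps //.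
move: (h 0) (h 1) (h 2); rewrite !mnmE /=.
by case: (nth _ _ i) => [[? ?] ?]; case: (nth _ _ j) => [[? ?] ?] /= -> -> ->.
Qed.

Section LexExpansion.
Variable k : fieldType.

Lemma lexmon_homog s (i : 'I_('C(s.+2, 2))) : lexmon k s i \is s.-homog.
Proof. by rewrite lexmonE dhomogX; apply/eqP/lexmnm_deg. Qed.

Lemma homog_lexE s (p : {mpoly k[3]}) : p \is s.-homog ->
  p = \sum_(i < 'C(s.+2, 2)) p@_(lexmnm s i) *: lexmon k s i.
Proof.
move=> hp; apply/mpolyP => m; rewrite raddf_sum /=.
case: (eqVneq (mdeg m) s) => [/lexmnm_surj[i <-]|hm].
  rewrite (bigD1 i) //= mcoeffZ lexmonE mcoeffX eqxx mulr1 big1 ?addr0 // => j hj.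
  rewrite mcoeffZ lexmonE mcoeffX; case: eqP => [/lexmnm_inj e|_]; last by rewrite mulr0.
  by rewrite e eqxx in hj.
rewrite (dhomog_nemf_coeff hp hm) big1 // => j _.
rewrite mcoeffZ lexmonE mcoeffX; case: eqP => [e|_]; last by rewrite mulr0.
by rewrite -e lexmnm_deg ?eqxx in hm.
Qed.

Lemma homog_ind s (Q : {mpoly k[3]} -> Prop) :
  Q 0 -> (forall g g', Q g -> Q g' -> Q (g + g')) ->
  (forall c (i : 'I_('C(s.+2, 2))), Q (c *: lexmon k s i)) ->
  forall g, g \is s.-homog -> Q g.
Proof. by move=> Q0 QD QZ g /homog_lexE ->; elim/big_ind: _. Qed.

Lemma lexmon_free s (c : 'I_('C(s.+2, 2)) -> k) :
  \sum_i c i *: lexmon k s i = 0 -> forall i, c i = 0.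
Proof.
move=> h i; have := congr1 (fun p => p@_(lexmnm s i)) h.
rewrite mcoeff0 raddf_sum /= (bigD1 i) //= mcoeffZ lexmonE mcoeffX eqxx mulr1.
rewrite big1 ?addr0 // => j hj; rewrite mcoeffZ lexmonE mcoeffX.
by case: eqP => [/lexmnm_inj e|_]; [rewrite e eqxx in hj | rewrite mulr0].
Qed.

Lemma mpolyX_neq0 a (m : 'X_{1..a}) : ('X_[m] : {mpoly k[a]}) != 0.
Proof.
apply/negP => /eqP/(congr1 (fun p => p@_m))/eqP.
by rewrite mcoeffX eqxx mcoeff0 oner_eq0.
Qed.

Lemma homog1E (p : {mpoly k[3]}) : p \is 1.-homog ->
  p = \sum_c p@_U_(c) *: 'X_c.
Proof.
move=> hp; apply/mpolyP => m; rewrite raddf_sum /=.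
case: (eqVneq (mdeg m) 1%N) => [/eqP|hm].
  rewrite mdeg_eq1 => /existsP[i /eqP ->].
  rewrite (bigD1 i) //= mcoeffZ mcoeffX eqxx mulr1 big1 ?addr0 // => j hj.
  rewrite mcoeffZ mcoeffX; case: eqP => [/mnmP/(_ i)|_]; last by rewrite mulr0.
  by rewrite !mnm1E eqxx (negbTE hj).
rewrite (dhomog_nemf_coeff hp hm) big1 // => j _.
rewrite mcoeffZ mcoeffX; case: eqP => [e|_]; last by rewrite mulr0.
by rewrite -e mdeg1 eqxx in hm.
Qed.

(** Multiplication by a form shifts the grading, so a cofactor in a homogeneous identity may be
    replaced by its component of the right degree. *)
Lemma pihomog_mull D e (p q : {mpoly k[3]}) :
  p \is D.-homog -> pihomog mdeg (D + e) (p * q) = p * pihomog mdeg e q.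
Proof.
move=> hp; rewrite {1}[q](pihomog_partitionE (mf := mdeg) (leqnn _)) mulr_sumr raddf_sum /=.
rewrite [in RHS](pihomog_partitionE (mf := mdeg) (leqnn _) : q = _) raddf_sum mulr_sumr /=.
apply: eq_bigr => i _; case: (eqVneq (i : nat) e) => [<-|ne].
  by rewrite pihomog_id pihomog_dE //; apply: dhomogM => //; apply: pihomogP.
rewrite (pihomog_ne0 ne) ?pihomogP // mulr0.
by apply: (@pihomog_ne0 _ _ _ (D + i)%N); rewrite ?eqn_add2l // dhomogM // pihomogP.
Qed.

Lemma pihomog_mull_lt D e (p q : {mpoly k[3]}) :
  (e < D)%N -> p \is D.-homog -> pihomog mdeg e (p * q) = 0.
Proof.
move=> hD hp; rewrite [q](pihomog_partitionE (mf := mdeg) (leqnn _)) mulr_sumr raddf_sum /=.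
apply: big1 => i _; apply: (@pihomog_ne0 _ _ _ (D + i)%N).
  by rewrite neq_ltn (leq_trans hD (leq_addr _ _)) orbT.
by rewrite dhomogM // pihomogP.
Qed.

End LexExpansion.

(** * Reduction modulo a linear form *)

Section ModuloLinearForm.
Variables (k : fieldType) (s : k).
Local Notation R := {mpoly k[3]}.

(** As s varies, the coefficient vectors (s^2, s, 1) run along a conic, so a given point lies on
    [ell] for at most two values of s. The coefficient 1 allows ['X_2] to be eliminated. *)
Definition ell : R := 'X_2 + s *: 'X_1 + s ^+ 2 *: 'X_0.

Definition rho_pt (c : 'I_3) : R :=
  if c == 2 then - (s *: 'X_1) - s ^+ 2 *: 'X_0 else 'X_c.

(* Reduction modulo [ell]: the retraction of R onto k[w1, w2] with kernel (ell). *)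
Local Notation rho := (subst rho_pt).

Lemma rho0 : rho 'X_0 = 'X_0. Proof. exact: substXU. Qed.
Lemma rho1 : rho 'X_1 = 'X_1. Proof. exact: substXU. Qed.

Lemma rho_ell : rho ell = 0.
Proof.
rewrite /ell !raddfD /= !comp_mpolyZ rho0 rho1 substXU /rho_pt /=.
by rewrite -!mul_mpolyC; ring.
Qed.

Lemma ell_homog : ell \is 1.-homog.
Proof. by rewrite /ell !rpredD ?rpredZ // dhomogX /= mdeg1. Qed.

Lemma msize_ell : msize ell = 2.
Proof.
have nz : ell != 0.
  apply/negP => /eqP h; have := congr1 (fun p => p@_U_(2)) h.
  rewrite /ell !mcoeffD !mcoeffZ !mcoeffX mcoeff0 eqxx.
  have -> : (U_(1%R) == U_(2%R) :> 'X_{1..3})%MM = false by apply/eqP => /mnmP/(_ 2); rewrite !mnm1E.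
  have -> : (U_(0%R) == U_(2%R) :> 'X_{1..3})%MM = false by apply/eqP => /mnmP/(_ 2); rewrite !mnm1E.
  by rewrite !mulr0 !addr0 => /eqP; rewrite oner_eq0.
have := dhomog_msize ell_homog; move/(dhomog_uniq nz)/(_ ell_homog).
by case: (msize ell) (msize_poly_eq0 ell) => [|[|[|]]] //; rewrite (negbTE nz).
Qed.

Lemma ell_neq0 : ell != 0.
Proof. by rewrite -msize_poly_eq0 msize_ell. Qed.

Definition mod_ideal (g : R) (p : R) := exists q, p = g * q.

Lemma mod_ideal_is_ideal g : is_ideal (mod_ideal g).
Proof.
split; first by exists 0; rewrite mulr0.
- by move=> a b [q ->] [q' ->]; exists (q + q'); rewrite mulrDr.
by move=> a b [q ->]; exists (a * q); rewrite mulrCA.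
Qed.

Lemma rho_congr p : exists q, p = rho p + ell * q.
Proof.
suff [q hq] : mod_ideal ell (subst (fun c => 'X_c) p - rho p).
  by exists q; rewrite -hq subst_id addrC subrK.
apply: subst_congr; first exact: mod_ideal_is_ideal.
apply: ord3P; rewrite /rho_pt /=; [exists 0|exists 0|exists 1]; rewrite ?mulr0 ?subrr //.
by rewrite mulr1 opprD !opprK addrA.
Qed.

Lemma rho_eq0 p : rho p = 0 -> exists q, p = ell * q.
Proof. by move=> h; have [q hq] := rho_congr p; exists q; rewrite {1}hq h add0r. Qed.

Lemma rho_eq0_homog e p : p \is e.+1.-homog -> rho p = 0 ->
  exists2 q, q \is e.-homog & p = ell * q.
Proof.
move=> hp /rho_eq0[q hq]; exists (pihomog mdeg e q); first exact: pihomogP.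
by rewrite -(pihomog_mull _ _ ell_homog) -hq pihomog_dE.
Qed.

Lemma rho_homog e p : p \is e.-homog -> rho p \is e.-homog.
Proof.
rewrite -{2}[e]mul1n; apply: subst_homog => i; rewrite /rho_pt.
by case: ifP; rewrite ?rpredB ?rpredN ?rpredZ // dhomogX /= mdeg1.
Qed.

Definition mon2 (d i : nat) : R := 'X_0 ^+ i * 'X_1 ^+ (d - i).
Definition mnm2 (d i : nat) : 'X_{1..3} := (U_(0%R) *+ i + U_(1%R) *+ (d - i))%MM.

Lemma mon2E d i : mon2 d i = 'X_[mnm2 d i].
Proof. by rewrite /mon2 /mnm2 mpolyXD -!mpolyXn. Qed.

(** The image of [rho] is fixed by the substitution w3 = 0, hence free of w3. *)
Lemma rho_coeff p (m : 'X_{1..3}) : m 2 != 0%N -> (rho p)@_m = 0.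
Proof.
move=> hm; pose th (c : 'I_3) : R := if c == 2 then 0 else 'X_c.
have -> : rho p = subst th (rho p).
  rewrite subst_subst; apply: eq_subst; apply: ord3P; rewrite /rho_pt /= ?substXU //.
  by rewrite raddfB raddfN /= !comp_mpolyZ !substXU.
rewrite substE raddf_sum /= big1 // => m' _; rewrite mcoeffZ prod_ord3 /th /=.
case: (eqVneq (m' 2) 0%N) => h; last by rewrite expr0n (negbTE h) mulr0 mcoeff0 mulr0.
rewrite h expr0 mulr1 !mpolyXn -mpolyXD mcoeffX.
case: eqP => [e|_]; last by rewrite mulr0.
by rewrite -e mnmDE !mulmnE !mnm1E in hm.
Qed.

Lemma rho_mon2E d p : p \is d.-homog ->
  rho p = \sum_(i < d.+1) (rho p)@_(mnm2 d i) *: mon2 d i.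
Proof.
move=> hp; apply/mpolyP => m; rewrite [RHS]raddf_sum /=.
under eq_bigr do rewrite mcoeffZ mon2E mcoeffX.
case: (eqVneq (mdeg m) d) => [hd|hm]; last first.
  rewrite (dhomog_nemf_coeff (rho_homog hp) hm) big1 // => j _.
  case: eqP => [e|_]; last by rewrite mulr0.
  by move: hm; rewrite -e mdegD !mdegMn !mdeg1 !mul1n subnKC ?eqxx // -ltnS.
case: (eqVneq (m 2) 0%N) => h2; last first.
  rewrite rho_coeff // big1 // => j _; case: eqP => [e|_]; last by rewrite mulr0.
  by move: h2; rewrite -e mnmDE !mulmnE !mnm1E.
have hi : (m 0%R < d.+1)%N by rewrite -hd mdeg3 ltnS -addnA leq_addr.
have mE : mnm2 d (m 0%R) = m.
  apply/mnmP; apply: ord3P; rewrite mnmDE !mulmnE !mnm1E /= -?hd ?mdeg3 ?h2; lia.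
rewrite (bigD1 (Ordinal hi)) //= mE eqxx mulr1 big1 ?addr0 // => j hj.
case: eqP => [e|_]; last by rewrite mulr0.
move/negP: hj; case; apply/eqP/val_inj => /=.
by rewrite -e mnmDE !mulmnE !mnm1E /= mul1n mul0n addn0.
Qed.

(* Setting w1 = 0 shows that w1 divides [g 0] modulo [ell]; subtracting a multiple of the
   first relation makes the whole syzygy divisible by w1. *)
Lemma mon2_syzygy d (g : nat -> R) :
  \sum_(i < d.+1) rho (g i) * mon2 d i = 0 ->
  exists c : nat -> R, forall j, (j <= d)%N ->
    mod_ideal ell (g j - (if j is j'.+1 then c j' * 'X_1 else 0)
                       + (if (j < d)%N then c j * 'X_0 else 0)).
Proof.
elim: d g => [|d IH] g.
  rewrite big_ord1 /mon2 !expr0 !mulr1 => /rho_eq0[q hq].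
  by exists (fun=> 0) => -[|//] _; exists q; rewrite subr0 addr0.
rewrite big_ord_recl /=.
have E : \sum_(i < d.+1) rho (g (bump 0 i)) * mon2 d.+1 (bump 0 i) =
    'X_0 * \sum_(i < d.+1) rho (g i.+1) * mon2 d i.
  by rewrite mulr_sumr; apply: eq_bigr => i _; rewrite /mon2 /bump add1n subSS exprS; ring.
rewrite E /mon2 expr0 mul1r subn0 => hg.
pose ka (c : 'I_3) : R := if c == 0 then 0 else 'X_c.
have [c0 hc0] : mod_ideal 'X_0 (rho (g 0%N)).
  have h0 : subst ka (rho (g 0%N)) = 0.
    have := congr1 (subst ka) hg.
    rewrite comp_mpolyD !rmorphM /= rmorphXn /= !substXU /ka /= mul0r addr0 comp_mpoly0.
    move/eqP; rewrite mulf_eq0 => /orP[/eqP //|].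
    by rewrite expf_eq0 (negbTE (mpolyX_neq0 _ _)) andbF.
  rewrite -[rho _]subr0 -h0 -{1}[rho _]subst_id.
  apply: subst_congr; first exact: mod_ideal_is_ideal.
  apply: ord3P; rewrite /ka /=; [exists 1|exists 0|exists 0]; rewrite ?mulr0 ?subrr //.
  by rewrite subr0 mulr1.
have [q0 hq0] := rho_congr (g 0%N).
have rc0 : rho (g 0%N) = 'X_0 * rho c0.
  have := congr1 (subst rho_pt) hq0.
  by rewrite hc0 comp_mpolyD !rmorphM /= rho_ell mul0r addr0 rho0.
(* The term of index 0 reduces to w1 c0 w2^(d+1); after division by w1, the factor c0 w2 is absorbed
   into the coefficient of w2^d. *)
pose g1 i := if i is i'.+1 then g i'.+2 else g 1%N + c0 * 'X_1.
have /IH[c hc] : \sum_(i < d.+1) rho (g1 i) * mon2 d i = 0.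
  have : 'X_0 * (\sum_(i < d.+1) rho (g1 i) * mon2 d i) = 0.
    rewrite -[RHS]hg rc0 -mulrA -mulrDr; congr (_ * _).
    rewrite big_ord_recl [in RHS]big_ord_recl /= comp_mpolyD rmorphM /= rho1.
    rewrite addrA; congr (_ + _).
    by rewrite /mon2 !expr0 !subn0 exprS; ring.
  by move/eqP; rewrite mulf_eq0 (negbTE (mpolyX_neq0 _ _)) => /eqP.
(* The first relation has entry - w1 in position 0, hence the coefficient - c0. *)
exists (fun j => if j is j'.+1 then c j' else - c0) => -[_|[_|j hj]].
- by exists q0; rewrite subr0 {1}hq0 hc0 ltn0Sn; ring.
- have [q hq] := hc 0%N (leq0n _); exists q; rewrite -hq ltnS /=.
  by rewrite subr0 mulNr opprK.
by have [q hq] := hc j.+1 hj; exists q; rewrite -hq ltnS.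
Qed.

End ModuloLinearForm.

(** * Syzygies *)

Section MonomialLeadingForms.
Variables (k : fieldType) (s : k) (d : nat).
Local Notation R := {mpoly k[3]}.
Local Notation rho := (subst (rho_pt s)).
Local Notation ell := (ell s).
Variables (F : 'I_d.+1 -> R) (a : 'I_d -> 'I_d.+1 -> k).
Hypothesis rhoF : forall i, rho (F i) = mon2 k d i.
Hypothesis aF : forall i : 'I_d,
  'X_1 * F (lift ord0 i) - 'X_0 * F (widen_ord (leqnSn d) i) = ell * \sum_j a i j *: F j.

(** The relation between the consecutive binary monomials w1^i w2^(d-i) and w1^(i+1) w2^(d-i-1), as
    a row vector. *)
Definition syz0 (i : 'I_d) (j : 'I_d.+1) : R :=
  (j == i.+1 :> nat)%:R * 'X_1 - (j == i :> nat)%:R * 'X_0.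

(** The multiple of [ell] supplied by [aF] corrects the relation modulo [ell] to an exact syzygy of
    [F]. *)
Definition syz (i : 'I_d) (j : 'I_d.+1) : R := syz0 i j - a i j *: ell.

Lemma natr_homog1 (b : bool) (c : 'I_3) : b%:R * 'X_c \is [in k[3], 1.-homog].
Proof. by case: b; rewrite ?mul1r ?mul0r ?rpred0 // dhomogX /= mdeg1. Qed.

Lemma syz_homog i j : syz i j \is 1.-homog.
Proof. by rewrite !rpredB ?natr_homog1 // rpredZ ?ell_homog. Qed.

Lemma sum_syz0 i (f : 'I_d.+1 -> R) :
  \sum_j syz0 i j * f j = 'X_1 * f (lift ord0 i) - 'X_0 * f (widen_ord (leqnSn d) i).
Proof.
under eq_bigr do rewrite mulrBl.
rewrite sumrB; congr (_ - _).
  rewrite (bigD1 (lift ord0 i)) //= eqxx mul1r big1 ?addr0 // => j hj.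
  case: eqP => [e|_]; last by rewrite !mul0r.
  by move/negP: hj; case; apply/eqP/val_inj.
rewrite (bigD1 (widen_ord (leqnSn d) i)) //= eqxx mul1r big1 ?addr0 // => j hj.
case: eqP => [e|_]; last by rewrite !mul0r.
by move/negP: hj; case; apply/eqP/val_inj.
Qed.

Lemma syzF i : \sum_j syz i j * F j = 0.
Proof.
under eq_bigr do rewrite mulrBl -scalerAl.
rewrite sumrB sum_syz0 aF mulr_sumr; apply/eqP; rewrite subr_eq0; apply/eqP.
by apply: eq_bigr => j _; rewrite scalerAr.
Qed.

(** Subtracting known syzygies and cancelling [ell] in the domain R leaves a syzygy, to which
    induction applies. *)
Lemma syz_ell_quotient (g g' : 'I_d.+1 -> R) (c : 'I_d -> R) : \sum_j g j * F j = 0 ->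
  (forall j, g j = \sum_i c i * syz i j + ell * g' j) -> \sum_j g' j * F j = 0.
Proof.
move=> hg gE; have : ell * \sum_j g' j * F j = 0.
  rewrite -[RHS]hg mulr_sumr.
  have -> : \sum_j g j * F j = \sum_j \sum_(i < d) c i * (syz i j * F j)
             + \sum_j ell * (g' j * F j).
    rewrite -big_split; apply: eq_bigr => j _ /=; rewrite gE mulrDl mulr_suml mulrA.
    by congr (_ + _); apply: eq_bigr => i _; rewrite mulrA.
  rewrite [X in _ = X + _]exchange_big [X in _ = X + _]big1 ?add0r // => i _ /=.
  by rewrite -mulr_sumr syzF mulr0.
by move/eqP; rewrite mulf_eq0 (negbTE (ell_neq0 s)) => /eqP.
Qed.

(** Modulo [ell] the F_j become binary monomials, whose syzygies are known from [mon2_syzygy]. *)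
Lemma syz_mod_ell (g : 'I_d.+1 -> R) : \sum_j g j * F j = 0 ->
  exists (c : 'I_d -> R) (g' : 'I_d.+1 -> R),
    forall j, g j = \sum_i c i * syz i j + ell * g' j.
Proof.
move=> hg.
have /(@mon2_syzygy _ _ _ (fun i => g (inord i)))[c hc] : \sum_(i < d.+1) rho (g (inord i)) * mon2 k d i = 0.
  have := congr1 (subst (rho_pt s)) hg.
  rewrite [subst _ 0]comp_mpoly0 => E; rewrite -[RHS]E [RHS]raddf_sum.
  by apply: eq_bigr => i _; rewrite /= rmorphM /= rhoF inord_val.
have hc' j : exists q, g j = \sum_(i < d) c i * syz0 i j + ell * q.
  have := hc j; rewrite -ltnS ltn_ord inord_val => /(_ isT)[q hq].
  exists q; rewrite -hq; set X := (X in X - _ + _); set Y := (Y in _ - Y + _).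
  set Z := (Z in _ - _ + Z).
  suff -> : \sum_(i < d) c i * syz0 i j = Y - Z.
    have E (x y z : R) : x = y - z + (x - y + z) by ring.
    exact: E.
  under eq_bigr do rewrite mulrBr.
  rewrite sumrB /Y /Z; congr (_ - _).
    case: j {hq Y Z X} => -[|j] hj /=.
      by rewrite big1 // => i _; rewrite mul0r mulr0.
    rewrite (bigD1 (Ordinal (hj : (j < d)%N))) //= eqxx mul1r big1 ?addr0 // => i hi.
    case: eqP => [[e]|_]; last by rewrite mul0r mulr0.
    by move/negP: hi; case; apply/eqP/val_inj.
  case: ifP => hj.
    rewrite (bigD1 (Ordinal hj)) //= eqxx mul1r big1 ?addr0 // => i hi.
    case: eqP => [e|_]; last by rewrite mul0r mulr0.
    by move/negP: hi; case; apply/eqP/val_inj.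
  rewrite big1 // => i _; case: eqP => [e|_]; last by rewrite mul0r mulr0.
  by rewrite e ltn_ord in hj.
(* Replacing [syz0] by [syz] changes the sum by a multiple of [ell], absorbed into the quotient. *)
have {}hc' j : exists q, g j == \sum_(i < d) c i * syz i j + ell * q.
  have [q ->] := hc' j; exists (q + \sum_(i < d) a i j *: c i).
  apply/eqP; rewrite mulrDr addrCA addrC; congr (_ + _).
  rewrite mulr_sumr -big_split; apply: eq_bigr => i _ /=.
  by rewrite /syz -!mul_mpolyC; ring.
pose g' j := xchoose (hc' j).
have hg' j : g j = \sum_(i < d) c i * syz i j + ell * g' j.
  by apply/eqP/(xchooseP (hc' j)).
by exists c, g'.
Qed.

(** Induction on the degree: up to the rows of [syz], g is [ell] times a syzygy of degree one less.
    In degree 0 the right-hand side has no component, so g = 0. *)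
Lemma syz_generate e (g : 'I_d.+1 -> R) : (forall j, g j \is e.-homog) ->
  \sum_j g j * F j = 0 -> exists c : 'I_d -> R, forall j, g j = \sum_i c i * syz i j.
Proof.
elim: e g => [|e IH] g hom hg; have [c [g' gE]] := syz_mod_ell hg.
  exists (fun=> 0) => j; rewrite big1 => [|i _]; last by rewrite mul0r.
  rewrite -(pihomog_dE (hom j)) gE raddfD /= raddf_sum big1 => [|i _] /=.
    by rewrite add0r (pihomog_mull_lt _ _ (ell_homog s)).
  by rewrite mulrC (pihomog_mull_lt _ _ (syz_homog i j)).
have {}gE j : g j = \sum_i pihomog mdeg e (c i) * syz i j + ell * pihomog mdeg e (g' j).
  rewrite -(pihomog_dE (hom j)) gE raddfD /=.
  rewrite (pihomog_mull e _ (ell_homog s) : pihomog mdeg e.+1 _ = _).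
  congr (_ + _); rewrite raddf_sum; apply: eq_bigr => i _ /=.
  by rewrite mulrC (pihomog_mull e _ (syz_homog i j) : pihomog mdeg e.+1 _ = _) mulrC.
have [||c' hc'] := IH (fun j => pihomog mdeg e (g' j)); first by move=> j; apply: pihomogP.
  exact: syz_ell_quotient hg gE.
exists (fun i => pihomog mdeg e (c i) + ell * c' i) => j.
rewrite gE hc' mulr_sumr -big_split; apply: eq_bigr => i _ /=.
by rewrite [RHS]mulrDl -[ell * c' i * _]mulrA.
Qed.

(** Descent on the size: modulo [ell] the rows form a bidiagonal matrix, so [ell] divides every c_i,
    and the quotients satisfy the same relation. *)
Lemma syz_free (c : 'I_d -> R) :
  (forall j, \sum_i c i * syz i j = 0) -> forall i, c i = 0.
Proof.
suff gen N : (forall i, msize (c i) <= N)%N ->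
    (forall j, \sum_i c i * syz i j = 0) -> forall i, c i = 0.
  by apply: (gen (\max_i msize (c i))%N) => i; apply: leq_bigmax.
elim: N c => [|N IH] c hN hc.
  by move=> i; apply/eqP; rewrite -msize_poly_eq0 -leqn0.
have rc : forall j, \sum_i rho (c i) * syz0 i j = 0.
  move=> j; have := congr1 (subst (rho_pt s)) (hc j).
  rewrite [subst _ 0]comp_mpoly0 => E; rewrite -[RHS]E [RHS]raddf_sum.
  apply: eq_bigr => i _; rewrite /= rmorphM /= /syz comp_mpolyB comp_mpolyZ rho_ell scaler0 subr0.
  by congr (_ * _); rewrite /syz0 comp_mpolyB !rmorphM /= rho0 rho1 !rmorph_nat.
(* Column i involves only c_(i-1) and c_i, so the reductions vanish one after the other. *)
have rc0 : forall m (i : 'I_d), i = m :> nat -> rho (c i) = 0.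
  elim/ltn_ind=> m IHm i hi; have := rc (widen_ord (leqnSn d) i).
  rewrite (bigD1 i) //= big1 => [|i' ne].
    rewrite addr0 /syz0 /= eqxx ltn_eqF // mul0r sub0r mul1r mulrN => /eqP.
    by rewrite oppr_eq0 mulf_eq0 (negbTE (mpolyX_neq0 _ _)) orbF => /eqP.
  rewrite /syz0 /=; case: eqP => [e|_]; first by rewrite (IHm i') ?mul0r // -hi e.
  by rewrite eq_sym (inj_eq val_inj) (negbTE ne) !mul0r subr0 mulr0.
have hq i : exists q, c i == ell * q.
  by have [q hq] := rho_eq0 (rc0 _ i erefl); exists q; apply/eqP.
pose c' i := xchoose (hq i).
have cE i : c i = ell * c' i by apply/eqP/(xchooseP (hq i)).
suff h : forall i, c' i = 0 by move=> i; rewrite cE h mulr0.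
apply: IH => [i|].
  case: (eqVneq (c' i) 0) => [->|nz]; first by rewrite msize0.
  by have := hN i; rewrite cE msizeM ?ell_neq0 // msize_ell.
move=> j; have := hc j; under eq_bigr do rewrite cE -mulrA.
by rewrite -mulr_sumr => /eqP; rewrite mulf_eq0 (negbTE (ell_neq0 s)) => /eqP.
Qed.

End MonomialLeadingForms.

Lemma basis_changeK (k : fieldType) (V : lmodType k) n (M N : 'I_n -> 'I_n -> k)
    (f : 'I_n -> V) i :
  (forall j, \sum_l M i l * N l j = (i == j)%:R) ->
  \sum_l M i l *: \sum_j N l j *: f j = f i.
Proof.
move=> h; under eq_bigr do rewrite scaler_sumr.
rewrite exchange_big (bigD1 i) //= [X in _ + X]big1 => [|j ne];
  under eq_bigr do rewrite scalerA.
  by rewrite -scaler_suml h eqxx scale1r addr0.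
by rewrite -scaler_suml h eq_sym (negbTE ne) scale0r.
Qed.

(** * Hilbert-Burch for the forms of degree d through the points *)

Section HilbertBurch.
Variables (k : fieldType) (hchar : [pchar k] =i pred0) (d' N : nat).
Local Notation d := d'.+1.
Local Notation R := {mpoly k[3]}.
Variables (P : 'I_N -> 'rV[k]_3) (F : 'I_d.+1 -> R).
Hypothesis P_neq0 : forall a, P a != 0.
Hypothesis no_form : forall H : R, H \is d'.-homog ->
  (forall a, H.@[coords (P a)] = 0) -> H = 0.
Hypothesis F_homog : forall j, F j \is d.-homog.
Hypothesis F_van : forall j a, (F j).@[coords (P a)] = 0.
Hypothesis F_free : forall c : 'I_d.+1 -> k, \sum_j c j *: F j = 0 -> forall j, c j = 0.

(** The value of [ell s] at a point is a polynomial in s whose coefficients are the coordinates of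
    the point; a non-root of the product over all points works. *)
Lemma exists_ell : exists s : k, forall a, (ell s).@[coords (P a)] != 0.
Proof.
pose q a : {poly k} := (P a 0 2)%:P + P a 0 1 *: 'X + P a 0 0 *: 'X^2.
have q_neq0 a : q a != 0.
  apply: contra (P_neq0 a) => /eqP q0.
  have h i : (q a)`_i = 0 by rewrite q0 coef0.
  have := h 0%N; have := h 1%N; have := h 2%N.
  rewrite /q !coefD !coefZ !coefC !coefX !coefXn /= !mulr1 !mulr0 !addr0 !add0r => h0 h1 h2.
  apply/eqP/matrixP => i j; rewrite ord1 mxE.
  by move: j; apply: ord3P.
have [s hs] : exists s, (\prod_a q a).[s] != 0.
  by apply: exists_nonroot => //; apply/prodf_neq0.
exists s => a; move: hs; rewrite horner_prod => /prodf_neq0/(_ a isT).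
rewrite /q /ell !hornerE !mevalD !mevalZ !mevalXU /coords.
by rewrite /= [s * _]mulrC expr2 [s * s * _]mulrC mulrA.
Qed.

(** A combination of the F_j that reduces to 0 is [ell] times a form of degree d - 1 vanishing on X,
    hence 0. So the square coefficient matrix [C] has trivial kernel. *)
Lemma homog_basis : exists (s : k) (C : 'M[k]_d.+1),
  [/\ C \in unitmx, (forall a, (ell s).@[coords (P a)] != 0) &
    forall j, subst (rho_pt s) (F j) = \sum_i C j i *: mon2 k d i].
Proof.
have [s hs] := exists_ell.
pose C := \matrix_(j < d.+1, i < d.+1) (subst (rho_pt s) (F j))@_(mnm2 d i).
have hC j : subst (rho_pt s) (F j) = \sum_i C j i *: mon2 k d i.
  by rewrite {1}(rho_mon2E s (F_homog j)); apply: eq_bigr => i _; rewrite mxE.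
exists s, C; split=> //.
rewrite -row_free_unit -kermx_eq0; apply/eqP/row_matrixP => r; rewrite row0.
have : row r (kermx C) *m C = 0 by rewrite -row_mul mulmx_ker row0.
move: (row r _) => v vC.
have rv : subst (rho_pt s) (\sum_j v 0 j *: F j) = 0.
  rewrite raddf_sum /=.
  under eq_bigr do rewrite comp_mpolyZ hC scaler_sumr.
  rewrite exchange_big big1 // => i _ /=.
  under eq_bigr do rewrite scalerA.
  by rewrite -scaler_suml; have /matrixP/(_ 0 i) := vC; rewrite !mxE => ->; rewrite scale0r.
have hv : \sum_j v 0 j *: F j \is d.-homog by apply: rpred_sum => j _; apply: rpredZ.
have [H Hhom HE] := rho_eq0_homog hv rv.
have H0 : H = 0.
  apply: no_form => // a; have := congr1 (meval (coords (P a))) HE.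
  rewrite raddf_sum big1 => [|j _] /=; last by rewrite mevalZ F_van mulr0.
  by move/esym/eqP; rewrite rmorphM mulf_eq0 (negbTE (hs a)) => /eqP.
move: HE; rewrite H0 mulr0 => /F_free v0.
by apply/matrixP => i j; rewrite ord1 v0 mxE.
Qed.

(** Subtracting the combination of the F_j with the same reduction leaves [ell] times a form of
    degree d - 1 vanishing on X, which is 0. *)
Lemma span_F (H : R) : H \is d.-homog -> (forall a, H.@[coords (P a)] = 0) ->
  exists c : 'I_d.+1 -> k, H = \sum_j c j *: F j.
Proof.
move=> Hhom Hvan; have [s [C [uC hs hC]]] := homog_basis.
pose v : 'rV[k]_d.+1 := (\row_i (subst (rho_pt s) H)@_(mnm2 d i)) *m invmx C.
exists (v 0); apply/eqP; rewrite -subr_eq0; apply/eqP.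
have rH : subst (rho_pt s) (H - \sum_j v 0 j *: F j) = 0.
  rewrite comp_mpolyB [X in _ - X]raddf_sum /= {1}(rho_mon2E s Hhom); apply/eqP; rewrite subr_eq0; apply/eqP.
  under [RHS]eq_bigr do rewrite comp_mpolyZ hC scaler_sumr.
  rewrite exchange_big; apply: eq_bigr => i _ /=.
  under [RHS]eq_bigr do rewrite scalerA.
  rewrite -scaler_suml; congr (_ *: _).
  have : v *m C = \row_i (subst (rho_pt s) H)@_(mnm2 d i) by rewrite mulmxKV.
  by move/matrixP/(_ 0 i); rewrite !mxE => ->.
have hH : H - \sum_j v 0 j *: F j \is d.-homog.
  apply: rpredB => //; apply: rpred_sum => j _; apply: rpredZ; exact: F_homog.
have [G Ghom GE] := rho_eq0_homog hH rH.
rewrite GE; suff -> : G = 0 by rewrite mulr0.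
apply: no_form => // a; have := congr1 (meval (coords (P a))) GE.
rewrite mevalB Hvan [X in _ - X = _]raddf_sum [X in _ - X = _]big1 => [|j _] /=; last by rewrite mevalZ F_van mulr0.
by rewrite subr0 => /esym/eqP; rewrite rmorphM mulf_eq0 (negbTE (hs a)) => /eqP.
Qed.

Theorem hilbert_burch : exists L : 'I_d -> 'I_d.+1 -> R,
  [/\ forall i j, L i j \is 1.-homog,
      forall i, \sum_j L i j * F j = 0,
      forall e (g : 'I_d.+1 -> R), (forall j, g j \is e.-homog) ->
        \sum_j g j * F j = 0 -> exists c : 'I_d -> R, forall j, g j = \sum_i c i * L i j &
      forall c : 'I_d -> R, (forall j, \sum_i c i * L i j = 0) -> forall i, c i = 0].
Proof.
have [s [C [uC hs hC]]] := homog_basis.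
pose D := invmx C.
have DC i j : \sum_l D i l * C l j = (i == j)%:R.
  by have /matrixP/(_ i j) := mulVmx uC; rewrite !mxE.
have CD i j : \sum_l C i l * D l j = (i == j)%:R.
  by have /matrixP/(_ i j) := mulmxV uC; rewrite !mxE.
(* The basis of the span of [F] whose reductions are the binary monomials. *)
pose F' i := \sum_j D i j *: F j.
have F'hom i : F' i \is d.-homog by apply: rpred_sum => j _; apply: rpredZ.
have rhoF' i : subst (rho_pt s) (F' i) = mon2 k d i.
  rewrite raddf_sum /=.
  under eq_bigr do rewrite comp_mpolyZ hC.
  by apply: basis_changeK (DC i).
have FE j : \sum_i C j i *: F' i = F j by apply: basis_changeK (CD j).
have FF' (g : 'I_d.+1 -> R) :
    \sum_i (\sum_j C j i *: g j) * F' i = \sum_j g j * F j.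
  under eq_bigr do rewrite mulr_suml.
  rewrite exchange_big; apply: eq_bigr => j _ /=; rewrite -FE mulr_sumr.
  by apply: eq_bigr => i _; rewrite -scalerAl -scalerAr.
(* The left-hand side reduces to 0 and vanishes on X, so its quotient by [ell] is a form of degree d
   vanishing on X, hence in the span. *)
have ha i : exists ai : 'I_d.+1 -> k,
    'X_1 * F' (lift ord0 i) - 'X_0 * F' (widen_ord (leqnSn d) i) =
      ell s * \sum_j ai j *: F' j.
  set E := 'X_1 * _ - _.
  have rE : subst (rho_pt s) E = 0.
    rewrite comp_mpolyB !rmorphM /= rho0 rho1 !rhoF' /mon2 /= /bump leq0n add1n.
    by rewrite exprS -(subnSK (ltn_ord i)) [in X in _ - X]exprS; ring.
  have hE : E \is d.+1.-homog.
    by apply: rpredB; apply: (@dhomogM _ _ _ 1 _ d); rewrite ?F'hom // dhomogX /= mdeg1.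
  have [G Ghom EG] := rho_eq0_homog hE rE.
  have [|c hc] := span_F Ghom.
    move=> b; have := congr1 (meval (coords (P b))) EG.
    have F'van j : (F' j).@[coords (P b)] = 0.
      by rewrite raddf_sum big1 // => l _ /=; rewrite mevalZ F_van mulr0.
    rewrite /E mevalB !rmorphM /= !F'van !mulr0 subr0.
    by move/esym/eqP; rewrite mulf_eq0 (negbTE (hs b)) => /eqP.
  exists (fun j => \sum_l c l * C l j); rewrite EG hc; congr (_ * _).
  under eq_bigr do rewrite -FE scaler_sumr.
  rewrite exchange_big; apply: eq_bigr => j _ /=; rewrite scaler_suml.
  by apply: eq_bigr => l _; rewrite scalerA.
have {ha}[a ha] := fin_all_exists ha.
(* The syzygies of [F'] rewritten in terms of the original [F]. *)
pose L i j := \sum_j' D j' j *: syz s a i j'.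
have Lsyz i j : \sum_j' C j' j *: L i j' = syz s a i j.
  apply: (@basis_changeK _ _ _ (fun j j' => C j' j) (fun j j' => D j' j)) => l.
  by rewrite eq_sym -DC; apply: eq_bigr => j' _; rewrite mulrC.
exists L; split.
- by move=> i j; apply: rpred_sum => j' _; apply: rpredZ; apply: syz_homog.
- move=> i; rewrite -FF' -[RHS](syzF ha i).
  by apply: eq_bigr => j _; rewrite Lsyz.
- move=> e g ghom; rewrite -FF' => hg.
  have [|c hc] := syz_generate rhoF' ha (e := e) _ hg.
    by move=> j; apply: rpred_sum => i _; apply: rpredZ; apply: ghom.
  exists c => j.
  rewrite -[LHS](@basis_changeK _ _ _ (fun j j' => D j' j) (fun j j' => C j' j)).
    under eq_bigr do rewrite hc scaler_sumr.
    rewrite exchange_big; apply: eq_bigr => i _ /=; rewrite /L mulr_sumr.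
    by apply: eq_bigr => j' _; rewrite scalerAr.
  by move=> l; rewrite eq_sym -CD; apply: eq_bigr => j' _; rewrite mulrC.
move=> c hc; apply: (@syz_free _ s d a) => j.
under eq_bigr do rewrite -Lsyz mulr_sumr.
rewrite exchange_big big1 // => j' _ /=.
under eq_bigr do rewrite -scalerAr.
by rewrite -scaler_sumr hc scaler0.
Qed.

End HilbertBurch.

(** * Separators of the points *)

Section Separators.
Variables (k : fieldType) (s : nat).
Local Notation N := 'C(s.+2, 2).
Variable P : 'I_N -> 'rV[k]_3.
Hypothesis rkP : hilb_fun P s = N.

(** There are as many points as monomials of degree s, so the evaluation matrix is square of full
    rank. *)
Lemma eval_mx_unit : eval_mx P s \in unitmx.
Proof. by rewrite -row_free_unit /row_free; apply/eqP. Qed.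

Lemma generic_no_form (H : {mpoly k[3]}) : H \is s.-homog ->
  (forall a, H.@[coords (P a)] = 0) -> H = 0.
Proof.
move=> hom van; rewrite (homog_lexE hom) big1 // => i _.
suff h : \row_i H@_(lexmnm s i) = 0 :> 'rV_N.
  by have /matrixP/(_ 0 i) := h; rewrite !mxE => ->; rewrite scale0r.
rewrite -[LHS](mulmxK eval_mx_unit); set E := _ *m eval_mx P s.
suff -> : E = 0 by rewrite mul0mx.
apply/matrixP => r a; rewrite /E mxE [RHS]mxE -[RHS](van a).
rewrite [in RHS](homog_lexE hom) [RHS]raddf_sum.
by apply: eq_bigr => i' _; rewrite !mxE /= mevalZ.
Qed.

(** The rows of the inverse evaluation matrix are the coefficient vectors of the separators; a form
    is determined by its values on X. *)
Lemma separators : exists S : 'I_N -> {mpoly k[3]},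
  [/\ forall a, S a \is s.-homog,
      forall a b, (S a).@[coords (P b)] = (a == b)%:R &
      forall H : {mpoly k[3]}, H \is s.-homog -> exists c : 'I_N -> k, H = \sum_a c a *: S a].
Proof.
pose S a := \sum_(i < N) invmx (eval_mx P s) a i *: lexmon k s i.
have Shom a : S a \is s.-homog.
  by apply: rpred_sum => i _; apply: rpredZ; apply: lexmon_homog.
have Sval a b : (S a).@[coords (P b)] = (a == b)%:R.
  have /matrixP/(_ a b) := mulVmx eval_mx_unit; rewrite !mxE => <-.
  by rewrite raddf_sum; apply: eq_bigr => i _; rewrite mxE /= mevalZ.
exists S; split=> // H hH; exists (fun a => H.@[coords (P a)]).
apply/eqP; rewrite -subr_eq0; apply/eqP/generic_no_form.
  by apply: rpredB => //; apply: rpred_sum => a _; apply: rpredZ; apply: Shom.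
move=> b; rewrite mevalB [X in _ - X]raddf_sum (bigD1 b) //= mevalZ Sval eqxx mulr1.
rewrite big1 ?addr0 ?subrr // => a ne.
by rewrite mevalZ Sval (negbTE ne) mulr0.
Qed.

End Separators.

Section LinearFormsAtPoint.
Variable k : fieldType.
Local Notation R := {mpoly k[3]}.

Lemma subst_lin M (l : {mpoly k[3]}) (t : 'I_3 -> {mpoly k[M]}) x y (q : 'I_3 -> k) :
  l \is 1.-homog ->
  subst (fun c => x * t c + y * (q c)%:MP) l = x * subst t l + y * (l.@[q])%:MP.
Proof.
move=> /homog1E ->; rewrite [LHS]raddf_sum [subst t _]raddf_sum [_.@[q]]raddf_sum.
rewrite [(\sum_i _)%:MP]raddf_sum !mulr_sumr -big_split.
apply: eq_bigr => c _ /=; rewrite !comp_mpolyZ !substXU mevalZ mevalXU mpolyCM.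
by rewrite -!mul_mpolyC; ring.
Qed.

(** With p_c0 nonzero, take w_c - (p_c / p_c0) w_c0 for the two other indices c. Modulo these, f
    becomes a multiple of f(p) = 0. The points q1, q2 are coordinate points dual to l1, l2. *)
Lemma point_forms (p : 'I_3 -> k) (c0 : 'I_3) : p c0 != 0 ->
  exists (l1 l2 : R) (q1 q2 : 'I_3 -> k),
  [/\ l1 \is 1.-homog /\ l2 \is 1.-homog,
      l1.@[p] = 0 /\ l2.@[p] = 0,
      [/\ l1.@[q1] = 1, l1.@[q2] = 0, l2.@[q1] = 0 & l2.@[q2] = 1] &
      forall e (f : R), f \is e.+1.-homog -> f.@[p] = 0 -> exists A B : R,
        [/\ A \is e.-homog, B \is e.-homog & f = A * l1 + B * l2]].
Proof.
move=> pc0.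
have [c1 [c2 [n1 n2 n12 all3]]] : exists c1 c2 : 'I_3,
    [/\ c1 != c0, c2 != c0, c1 != c2 & forall c, [|| c == c0, c == c1 | c == c2]].
  move: c0 {pc0}; apply: ord3P; [exists 1, 2|exists 0, 2|exists 0, 1]; split=> //;
    by apply: ord3P.
pose l c : R := 'X_c - (p c / p c0) *: 'X_c0.
have lhom c : l c \is 1.-homog by apply: rpredB; rewrite ?rpredZ // dhomogX /= mdeg1.
have lp c : (l c).@[p] = 0 by rewrite mevalB mevalZ !mevalXU divfK ?subrr.
have lq c c' : c' != c0 -> (l c).@[fun x => (x == c')%:R] = (c == c')%:R.
  by move=> ne; rewrite mevalB mevalZ !mevalXU [c0 == _]eq_sym (negbTE ne) mulr0 subr0.
exists (l c1), (l c2), (fun x => (x == c1)%:R), (fun x => (x == c2)%:R); split=> //.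
  by rewrite !lq // !eqxx (negbTE n12) eq_sym (negbTE n12).
move=> e f fhom fp.
pose I (g : R) := exists A B : R, g = A * l c1 + B * l c2.
have hI : is_ideal I.
  split; first by exists 0, 0; ring.
    by move=> _ _ [A [B ->]] [A' [B' ->]]; exists (A + A'), (B + B'); ring.
  by move=> g _ [A [B ->]]; exists (g * A), (g * B); ring.
have [A [B fAB]] : I f.
  rewrite -[f]subr0 -[f]subst_id.
  have <- : subst (fun c => 'X_c0 * (p c / p c0)%:MP) f = 0.
    rewrite (subst_scale (fun c => (p c / p c0)%:MP) _ fhom).
    suff -> : subst (fun c => (p c / p c0)%:MP) f = 0 :> R by rewrite mulr0.
    have -> : subst (fun c => (p c / p c0)%:MP) f = (f.@[fun c => p c / p c0])%:MP :> R.
      rewrite substE mevalE raddf_sum; apply: eq_bigr => m _ /=.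
      rewrite mpolyCM mul_mpolyC rmorph_prod; congr (_ *: _).
      by apply: eq_bigr => i _; rewrite rmorphXn.
    rewrite (meval_eq _ (fun c => mulrC (p c) (p c0)^-1)) (meval_scale _ _ fhom).
    by rewrite fp mulr0.
  apply: subst_congr => // c.
  have E c' : 'X_c' - 'X_c0 * (p c' / p c0)%:MP = l c' by rewrite /l -mul_mpolyC mulrC.
  rewrite E; case/or3P: (all3 c) => /eqP ->.
  - by rewrite /l divff // scale1r subrr; case: hI.
  - by exists 1, 0; ring.
  by exists 0, 1; ring.
exists (pihomog mdeg e A), (pihomog mdeg e B); split; try exact: pihomogP.
rewrite -(pihomog_dE fhom) fAB raddfD /= mulrC [B * _]mulrC.
have E g c := pihomog_mull e g (lhom c) : pihomog mdeg e.+1 _ = _.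
by rewrite !E; congr (_ + _); apply: mulrC.
Qed.

End LinearFormsAtPoint.

(** * Charts of the blowup *)

Section CoordinateForms.
Variables (k : fieldType) (n d : nat).
Local Notation R := {mpoly k[3]}.
Local Notation M := ('C(n.+2, 2) * d.+1)%N.
Implicit Types (g : R) (j : 'I_d.+1).

(* The linear form on P^p that pulls back to [g * F j], for [g] of degree n. *)
Definition xf g j : {mpoly k[M]} :=
  \sum_(i < 'C(n.+2, 2)) g@_(lexmnm n i) *: 'X_(mxvec_index i j).

Lemma xfD g g' j : xf (g + g') j = xf g j + xf g' j.
Proof.
by rewrite /xf -big_split; apply: eq_bigr => i _ /=; rewrite mcoeffD scalerDl.
Qed.

Lemma xf0 j : xf 0 j = 0.
Proof. by rewrite /xf big1 // => i _; rewrite mcoeff0 scale0r. Qed.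

Lemma xfZ c g j : xf (c *: g) j = c *: xf g j.
Proof.
by rewrite /xf scaler_sumr; apply: eq_bigr => i _; rewrite mcoeffZ scalerA.
Qed.

Lemma xf_sum I (r : seq I) (Q : pred I) (f : I -> R) j :
  xf (\sum_(i <- r | Q i) f i) j = \sum_(i <- r | Q i) xf (f i) j.
Proof.
rewrite /xf exchange_big; apply: eq_bigr => i _ /=.
by rewrite raddf_sum scaler_suml.
Qed.

Lemma xf_lexmon (i : 'I_('C(n.+2, 2))) j : xf (lexmon k n i) j = 'X_(mxvec_index i j).
Proof.
rewrite /xf (bigD1 i) //= lexmonE mcoeffX eqxx scale1r big1 ?addr0 // => i' ne.
rewrite mcoeffX; case: eqP => [/lexmnm_inj e|_]; last by rewrite scale0r.
by rewrite e eqxx in ne.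
Qed.

Lemma xf_homog g j : xf g j \is 1.-homog.
Proof. by apply: rpred_sum => i _; apply: rpredZ; rewrite dhomogX /= mdeg1. Qed.

Lemma meval_xf (F : 'I_d.+1 -> R) w g j : g \is n.-homog ->
  (xf g j).@[phi n F w] = g.@[w] * (F j).@[w].
Proof.
move=> hg; rewrite {2}(homog_lexE hg) [LHS]raddf_sum [X in X * _]raddf_sum mulr_suml.
apply: eq_bigr => i _ /=.
by rewrite !mevalZ mevalXU /phi mxvecE mxE rmorphM /= mulrA.
Qed.

(** The substitution [th] sends x_(i,j') to z_i if j' = j and to 0 otherwise, which isolates g_j. *)
Lemma xf_free (g : 'I_d.+1 -> R) : (forall j, g j \is n.-homog) ->
  \sum_j xf (g j) j = 0 -> forall j, g j = 0.
Proof.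
move=> hg h0 j.
pose th s : R := mxvec (\matrix_(i < 'C(n.+2, 2), j' < d.+1) ((j' == j)%:R * lexmon k n i)) 0 s.
have thx j' : subst th (xf (g j') j') = (j' == j)%:R * g j'.
  rewrite {2}(homog_lexE (hg j')) [LHS]raddf_sum mulr_sumr; apply: eq_bigr => i _ /=.
  by rewrite comp_mpolyZ substXU /th mxvecE mxE -scalerAr.
have := congr1 (subst th) h0; rewrite comp_mpoly0 raddf_sum (bigD1 j) //= thx eqxx mul1r.
by rewrite big1 ?addr0 // => j' ne; rewrite thx (negbTE ne) mul0r.
Qed.

Lemma xf_eq0 g j : g \is n.-homog -> xf g j = 0 -> g = 0.
Proof.
move=> hg h0; have := @xf_free (fun j' => if j' == j then g else 0).
move=> /(_ _ _ j); rewrite eqxx; apply; first by move=> j'; case: ifP; rewrite ?rpred0.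
rewrite (bigD1 j) //= eqxx h0 add0r big1 // => j' ne; rewrite (negbTE ne).
by rewrite xf0.
Qed.

End CoordinateForms.

(** * Computation modulo J on one chart *)

Section Chart.
Variables (k : fieldType) (n' d' : nat).
Local Notation R := {mpoly k[3]}.
Local Notation n := n'.+1.
Local Notation d := d'.+1.
Local Notation M := ('C(n.+2, 2) * d.+1)%N.
Local Notation xf := (@xf k n d).
Variables (L : 'I_d -> 'I_d.+1 -> R) (J : {mpoly k[M]} -> Prop).
Hypothesis hJ : is_ideal J.
Hypothesis swap_var : forall b b' (g g' : R) j j', g \is n'.-homog -> g' \is n'.-homog ->
  J (xf ('X_b * g) j * xf ('X_b' * g') j' - xf ('X_b' * g) j * xf ('X_b * g') j').
Hypothesis swap_idx : forall (g g' : R) j j', g \is n.-homog -> g' \is n.-homog ->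
  J (xf g j * xf g' j' - xf g j' * xf g' j).
Hypothesis linJ : forall i (g : R), g \is n'.-homog -> J (\sum_j xf (g * L i j) j).
Hypothesis L_homog : forall i j, L i j \is 1.-homog.

Variables (b : 'I_3) (j0 : 'I_d.+1).
(** On the image, the u_c are proportional to the w_c and the v_j to the F_j, and u_b = v_j0 = h. *)
Let h := xf ('X_b ^+ n) j0.
Let u c := xf ('X_b ^+ n' * 'X_c) j0.
Let v j := xf ('X_b ^+ n) j.

Lemma Xn_homog (c : 'I_3) e : 'X_c ^+ e \is [in k[3], e.-homog].
Proof. by rewrite -{2}[e]mul1n dhomogMn // dhomogX /= mdeg1. Qed.

Lemma chart_idx g j : g \is n.-homog -> J (h * xf g j - xf g j0 * v j).
Proof. by move=> hg; rewrite [xf g j0 * _]mulrC; apply: swap_idx; rewrite ?Xn_homog. Qed.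

(** Induction on e: each variable of m is traded for a w_b at the cost of one factor h. *)
Lemma chart_mon e m : (e <= n)%N -> mdeg m = e ->
  J (h ^+ e * xf ('X_b ^+ (n - e) * 'X_[m]) j0 - h * subst u 'X_[m]).
Proof.
elim: e m => [|e IH] m he hm.
  move/eqP: hm; rewrite mdeg_eq0 => /eqP ->.
  by rewrite expr0 subn0 mpolyX0 !mulr1 mul1r rmorph1 mulr1; apply: ideal_congr_refl.
have [c hc] : exists c, m c != 0%N.
  apply/existsP; rewrite -negb_forall; apply/negP => /forallP h0.
  by move: hm; rewrite mdegE big1 // => i _; apply/eqP.
have mE : m = (U_(c) + (m - U_(c)))%MM by rewrite addmC submK // lep1mP.
move: (m - U_(c))%MM mE => m' mE; rewrite mE in hm *.
have {}hm : mdeg m' = e by move: hm; rewrite mdegD mdeg1 => -[].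
have hn : (n - e = (n - e.+1).+1)%N by rewrite subnSK.
rewrite mpolyXD rmorphM /= substXU.
pose g : R := 'X_b ^+ (n - e.+1) * 'X_[m'].
have hg : g \is n'.-homog.
  have -> : n' = (n - e.+1 + e)%N by rewrite subSS subnK.
  by apply: dhomogM; rewrite ?Xn_homog // dhomogX; apply/eqP.
have -> : 'X_b ^+ (n - e.+1) * ('X_c * 'X_[m']) = 'X_c * g by rewrite /g; ring.
(* Exchanging w_c with a w_b of h turns h x_(w_c g) into x_(w_b g) u_c. *)
apply: (ideal_congr_trans hJ (b := h ^+ e * (xf ('X_b * g) j0 * u c))).
  rewrite exprSr -mulrA; apply: ideal_congr_mull => //.
  have := swap_var c b j0 j0 hg (Xn_homog b n').
  by rewrite -exprS ['X_c * 'X_b ^+ _]mulrC [xf ('X_c * g) j0 * _]mulrC.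
have -> : 'X_b * g = 'X_b ^+ (n - e) * 'X_[m'] by rewrite hn exprS mulrA.
have -> : h * (u c * subst u 'X_[m']) = (h * subst u 'X_[m']) * u c by ring.
rewrite mulrA; apply: ideal_congr_mul => //; last exact: ideal_congr_refl.
by apply: IH; rewrite // ltnW.
Qed.

Lemma chart_coord (i : 'I_('C(n.+2, 2))) j :
  J (h ^+ n.+1 * 'X_(mxvec_index i j) - h * subst u (lexmon k n i) * v j).
Proof.
rewrite -xf_lexmon exprSr -mulrA.
apply: (ideal_congr_trans hJ (b := h ^+ n * (xf (lexmon k n i) j0 * v j))).
  by apply: ideal_congr_mull => //; apply: chart_idx; apply: lexmon_homog.
rewrite mulrA; apply: ideal_congr_mul => //; last exact: ideal_congr_refl.
have := @chart_mon n (lexmnm n i) (leqnn _) (lexmnm_deg (ltn_ord i)).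
by rewrite subnn expr0 mul1r -lexmonE.
Qed.

Lemma subst_u_lin (l : R) : l \is 1.-homog -> subst u l = xf ('X_b ^+ n' * l) j0.
Proof.
move=> /homog1E ->; rewrite [LHS]raddf_sum mulr_sumr xf_sum; apply: eq_bigr => c _ /=.
by rewrite comp_mpolyZ substXU -scalerAr xfZ.
Qed.

(** By [chart_idx] the sum is congruent to h times a linear generator. *)
Lemma chart_L i : J (\sum_j subst u (L i j) * v j).
Proof.
apply: (ideal_congr_mem hJ (b := h * \sum_j xf ('X_b ^+ n' * L i j) j)).
  apply: ideal_congr_sym => //; rewrite mulr_sumr; apply: ideal_congr_sum => // j.
  rewrite subst_u_lin //; apply: chart_idx.
  by rewrite -[n]addn1; apply: dhomogM; rewrite ?Xn_homog.
by case: hJ => _ _; apply; apply: linJ; apply: Xn_homog.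
Qed.

Variable F : 'I_d.+1 -> R.
Hypothesis syz_gen : forall e (g : 'I_d.+1 -> R), (forall j, g j \is e.-homog) ->
  \sum_j g j * F j = 0 -> exists c : 'I_d -> R, forall j, g j = \sum_i c i * L i j.

Lemma chart_syz e (g : 'I_d.+1 -> R) : (forall j, g j \is e.-homog) ->
  \sum_j g j * F j = 0 -> J (\sum_j subst u (g j) * v j).
Proof.
move=> hg /(syz_gen hg)[c hc].
have -> : \sum_j subst u (g j) * v j = \sum_i subst u (c i) * \sum_j subst u (L i j) * v j.
  under [RHS]eq_bigr do rewrite mulr_sumr.
  rewrite exchange_big; apply: eq_bigr => j _ /=.
  rewrite hc [subst u _]raddf_sum mulr_suml; apply: eq_bigr => i _ /=.
  by rewrite rmorphM /= mulrA.
by apply: ideal_sum => // i _; case: hJ => _ _; apply; apply: chart_L.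
Qed.

(** The polynomial form of [phi]: vanishing of G on the image becomes an identity in R, into which
    any triple can be substituted. *)
Definition zF (s : 'I_M) : R := mxvec (\matrix_(i < 'C(n.+2, 2), j < d.+1) (lexmon k n i * F j)) 0 s.

(** * The chart near one point of X *)

Section Point.
Variables (S l1 l2 : R) (q : 'I_3 -> k) (A B : 'I_d.+1 -> R) (c1 c2 : 'I_d.+1 -> k).
Hypotheses (S_homog : S \is d'.-homog) (l1_homog : l1 \is 1.-homog) (l2_homog : l2 \is 1.-homog).
Hypotheses (l1q : l1.@[q] = 0) (l2q : l2.@[q] = 1) (l1_neq0 : l1 != 0).
Hypotheses (A_homog : forall j, A j \is d'.-homog) (B_homog : forall j, B j \is d'.-homog).
Hypothesis FE : forall j, F j = A j * l1 + B j * l2.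
Hypotheses (c1E : l1 * S = \sum_j c1 j *: F j) (c2E : l2 * S = \sum_j c2 j *: F j).
Let V1 := \sum_j c1 j *: v j.
Let V2 := \sum_j c2 j *: v j.

(** This is the syzygy read off from S F_j = A_j (l1 S) + B_j (l2 S). *)
Lemma chart_S j : J (subst u S * v j - (subst u (A j) * V1 + subst u (B j) * V2)).
Proof.
pose g j' := (j' == j)%:R *: S - c1 j' *: A j - c2 j' *: B j.
have hg j' : g j' \is d'.-homog.
  by apply: rpredB; [apply: rpredB|]; apply: rpredZ; [exact: S_homog|exact: A_homog|exact: B_homog].
have := chart_syz hg.
have sumE (T : lmodType k) (f : 'I_d.+1 -> T) : \sum_j' (j' == j)%:R *: f j' = f j.
  rewrite (bigD1 j) //= eqxx scale1r big1 ?addr0 // => j' ne.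
  by rewrite (negbTE ne) scale0r.
have -> : \sum_j' g j' * F j' = 0.
  rewrite (eq_bigr (fun j' => (j' == j)%:R *: (S * F j') - A j * (c1 j' *: F j')
      - B j * (c2 j' *: F j'))); last first.
    by move=> j' _; rewrite /g -!mul_mpolyC; ring.
  by rewrite !sumrB -!mulr_sumr -c1E -c2E sumE FE; ring.
move=> /(_ erefl); congr J.
rewrite (eq_bigr (fun j' => (j' == j)%:R *: (subst u S * v j') - subst u (A j) * (c1 j' *: v j')
    - subst u (B j) * (c2 j' *: v j'))); last first.
  by move=> j' _; rewrite /g !comp_mpolyB !comp_mpolyZ -!mul_mpolyC; ring.
by rewrite !sumrB -!mulr_sumr -/V1 -/V2 sumE; ring.
Qed.

(** This is the syzygy read off from l1 (l2 S) = l2 (l1 S). *)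
Lemma chart_l12 : J (V2 * subst u l1 - V1 * subst u l2).
Proof.
pose g j := c2 j *: l1 - c1 j *: l2.
have hg j : g j \is 1.-homog by rewrite rpredB ?rpredZ.
have := chart_syz hg.
have -> : \sum_j g j * F j = 0.
  rewrite (eq_bigr (fun j => l1 * (c2 j *: F j) - l2 * (c1 j *: F j))); last first.
    by move=> j _; rewrite /g -!mul_mpolyC; ring.
  by rewrite !sumrB -!mulr_sumr -c1E -c2E; ring.
move=> /(_ erefl); congr J; rewrite /V1 /V2 !mulr_suml -sumrB; apply: eq_bigr => j _.
by rewrite /g !comp_mpolyB !comp_mpolyZ -!mul_mpolyC; ring.
Qed.

(* A point congruent to [V1 * u] at which [l1], [l2] take the values [V1 * l1(u)] and
   [V2 * l1(u)] exactly: the chart of the blowup where the slope is [V2 / V1]. *)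
Let wh c := V1 * u c + (V2 * subst u l1 - V1 * subst u l2) * (q c)%:MP.

Lemma wh_congr f e : f \is e.-homog -> J (V1 ^+ e * subst u f - subst wh f).
Proof.
move=> hf; rewrite -(subst_scale _ _ hf); apply: subst_congr => // c.
rewrite /wh opprD addrA subrr sub0r; apply: ideal_opp => //.
by rewrite mulrC; case: hJ => _ _; apply; apply: chart_l12.
Qed.

Lemma wh_l1 : subst wh l1 = V1 * subst u l1.
Proof. by rewrite subst_lin // l1q mpolyC0 mulr0 addr0. Qed.

Lemma wh_l2 : subst wh l2 = V2 * subst u l1.
Proof. by rewrite subst_lin // l2q mpolyC1 mulr1 addrC subrK. Qed.

(** The coordinates z_i F_j at [wh] with the common factor l1(u) removed from F_j. *)
Let Phi s := mxvec (\matrix_(i < 'C(n.+2, 2), j < d.+1)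
  (subst wh (lexmon k n i) * (subst wh (A j) * V1 + subst wh (B j) * V2))) 0 s.

(** The factor h^(n+1) serves [chart_coord], S(u) serves [chart_S], and V1^(n+d') replaces u by [wh]
    in z_i of degree n and in A_j, B_j of degree d'. *)
Let f := h ^+ n.+1 * subst u S * V1 ^+ (n + d').

Lemma chart_Phi s : J (f * 'X_s - h * Phi s).
Proof.
case/mxvec_indexP: s => i j; rewrite /Phi mxvecE mxE.
set z := lexmon k n i.
have -> : f * 'X_(mxvec_index i j) =
    (subst u S * V1 ^+ (n + d')) * (h ^+ n.+1 * 'X_(mxvec_index i j)) by rewrite /f; ring.
apply: (ideal_congr_trans hJ); first by apply: ideal_congr_mull => //; apply: chart_coord.
have -> : subst u S * V1 ^+ (n + d') * (h * subst u z * v j) =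
   (h * subst u z * V1 ^+ (n + d')) * (subst u S * v j) by ring.
apply: (ideal_congr_trans hJ); first by apply: ideal_congr_mull => //; apply: chart_S.
have -> : h * subst u z * V1 ^+ (n + d') * (subst u (A j) * V1 + subst u (B j) * V2) =
   h * ((V1 ^+ n * subst u z) * ((V1 ^+ d' * subst u (A j)) * V1 + (V1 ^+ d' * subst u (B j)) * V2)).
  by rewrite exprD; ring.
apply: ideal_congr_mull => //; apply: ideal_congr_mul => //.
  by apply: wh_congr; apply: lexmon_homog.
by apply: ideal_congr_add => //; apply: ideal_congr_mul => //;
  [apply: wh_congr|exact: ideal_congr_refl|apply: wh_congr|exact: ideal_congr_refl].
Qed.

(** Since l1(u) [Phi] is [zF] at [wh], G vanishes there; cancelling l1(u)^e gives G([Phi]) = 0. Then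
    f^e G = G(f x) is congruent to G(h [Phi]) = 0. *)
Lemma chart_kill e (G : {mpoly k[M]}) : G \is e.-homog -> subst zF G = 0 -> J (f ^+ e * G).
Proof.
move=> hG G0.
(* l1(u) is the linear form attached to w_b^(n-1) l1, and [xf] is injective on forms of degree n. *)
have lu0 : subst u l1 != 0.
  have hl : 'X_b ^+ n' * l1 \is n.-homog by rewrite -[n]addn1; apply: dhomogM; rewrite ?Xn_homog.
  apply/negP => /eqP; rewrite subst_u_lin // => /(xf_eq0 hl)/eqP.
  by rewrite mulf_eq0 (negbTE l1_neq0) orbF expf_eq0 (negbTE (mpolyX_neq0 _ _)) andbF.
have Phi0 : subst Phi G = 0.
  have : subst u l1 ^+ e * subst Phi G = 0.
    rewrite -(subst_scale _ _ hG).
    have E s : subst u l1 * Phi s = subst wh (zF s).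
      case/mxvec_indexP: s => i j; rewrite /Phi /zF !mxvecE !mxE [RHS]rmorphM /= FE.
      move: (subst wh (lexmon k n i)) => z.
      by rewrite comp_mpolyD !rmorphM /= wh_l1 wh_l2; ring.
    by rewrite (eq_subst _ E) -subst_subst G0 comp_mpoly0.
  by move/eqP; rewrite mulf_eq0 expf_eq0 (negbTE lu0) andbF => /eqP.
rewrite -[G in _ * G]subst_id -(subst_scale _ _ hG).
apply: (ideal_congr_mem hJ (b := subst (fun s => h * Phi s) G)).
  by apply: subst_congr => // s; apply: chart_Phi.
by rewrite (subst_scale _ _ hG) Phi0 mulr0; case: hJ.
Qed.

End Point.

End Chart.

(** * From the charts to all coordinates *)

Section Cover.
Variables (k : fieldType) (hchar : [pchar k] =i pred0) (n' d' : nat).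
Local Notation R := {mpoly k[3]}.
Local Notation n := n'.+1.
Local Notation d := d'.+1.
Local Notation M := ('C(n.+2, 2) * d.+1)%N.
Local Notation N := 'C(d'.+2, 2).
Local Notation xf := (@xf k n d).
Variables (L : 'I_d -> 'I_d.+1 -> R) (J : {mpoly k[M]} -> Prop).
Hypothesis hJ : is_ideal J.
Hypothesis swap_var : forall b b' (g g' : R) j j', g \is n'.-homog -> g' \is n'.-homog ->
  J (xf ('X_b * g) j * xf ('X_b' * g') j' - xf ('X_b' * g) j * xf ('X_b * g') j').
Hypothesis swap_idx : forall (g g' : R) j j', g \is n.-homog -> g' \is n.-homog ->
  J (xf g j * xf g' j' - xf g j' * xf g' j).
Hypothesis linJ : forall i (g : R), g \is n'.-homog -> J (\sum_j xf (g * L i j) j).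
Hypothesis L_homog : forall i j, L i j \is 1.-homog.

Variables (P : 'I_N -> 'rV[k]_3) (F : 'I_d.+1 -> R).
Hypothesis syz_gen : forall e (g : 'I_d.+1 -> R), (forall j, g j \is e.-homog) ->
  \sum_j g j * F j = 0 -> exists c : 'I_d -> R, forall j, g j = \sum_i c i * L i j.
Hypothesis P_neq0 : forall a, P a != 0.
Hypothesis rkP : hilb_fun P d' = N.
Hypothesis F_homog : forall j, F j \is d.-homog.
Hypothesis F_van : forall j a, (F j).@[coords (P a)] = 0.
Hypothesis F_free : forall c : 'I_d.+1 -> k, \sum_j c j *: F j = 0 -> forall j, c j = 0.

Variables (e : nat) (G : {mpoly k[M]}).
Hypothesis G_homog : G \is e.-homog.
Hypothesis G_van : subst (zF F) G = 0.
Local Notation Q := (rad_colon J G).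

Section FixedChart.
Variables (b : 'I_3) (j0 : 'I_d.+1).
Let h := xf ('X_b ^+ n) j0.
Let u c := xf ('X_b ^+ n' * 'X_c) j0.
Let v j := xf ('X_b ^+ n) j.

(** The charts V1 and V2 together suffice, because h S(u) = v_j0 S(u) is a combination of V1 and V2
    modulo J. *)
Lemma rad_chart_separator (S : R) a : S \is d'.-homog ->
  (forall a', S.@[coords (P a')] = (a == a')%:R) -> Q (h * subst u S).
Proof.
move=> S_homog Sval.
have [c0 pc0] : exists c, coords (P a) c != 0.
  apply/existsP; rewrite -negb_forall; apply/negP => /forallP h0.
  move/negP: (P_neq0 a); case; apply/eqP/matrixP => i c; rewrite ord1 mxE.
  exact/eqP/(h0 c).
have [l1 [l2 [q1 [q2 [[hl1 hl2] [l1p l2p] [l11 l12 l21 l22] hdiv]]]]] := point_forms pc0.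
have {}hdiv j : exists AB : R * R,
    [/\ AB.1 \is d'.-homog, AB.2 \is d'.-homog & F j = AB.1 * l1 + AB.2 * l2].
  by have [A [B [? ? ?]]] := hdiv d' (F j) (F_homog j) (F_van j a); exists (A, B).
have {hdiv}[AB hAB] := fin_all_exists hdiv.
pose A j := (AB j).1; pose B j := (AB j).2.
have hA j : A j \is d'.-homog by case: (hAB j).
have hB j : B j \is d'.-homog by case: (hAB j).
have FE j : F j = A j * l1 + B j * l2 by case: (hAB j).
(* The product l S vanishes at the chosen point because l does, and at the others because S does. *)
have span l : l \is 1.-homog -> l.@[coords (P a)] = 0 ->
    exists c : 'I_d.+1 -> k, l * S = \sum_j c j *: F j.
  move=> hl lp; apply: (span_F hchar P_neq0 (generic_no_form rkP)) => //.
    by rewrite -[d]add1n; apply: dhomogM.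
  move=> a'; rewrite rmorphM /= Sval; case: eqP => [<-|_]; last by rewrite mulr0.
  by rewrite lp mul0r.
have [c1 c1E] := span _ hl1 l1p; have [c2 c2E] := span _ hl2 l2p.
have nz (l : R) q : l.@[q] = 1 -> l != 0.
  by move=> lq; apply/negP => /eqP l0; move/eqP: lq; rewrite l0 meval0 eq_sym oner_eq0.
pose V1 := \sum_j c1 j *: v j; pose V2 := \sum_j c2 j *: v j.
(* The exponent n + 1 + d' dominates those of h, S(u) and V in the multiplier. *)
have pull V : J ((h ^+ n.+1 * subst u S * V ^+ (n + d')) ^+ e * G) -> Q (h * subst u S * V).
  move=> hV; apply: (@rad_colon_exp _ _ _ (n.+1 + d')); apply: (@rad_colon_congr _ _ hJ _ _
    ((h ^+ d' * subst u S ^+ (n + d') * V) * (h ^+ n.+1 * subst u S * V ^+ (n + d')))).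
    have -> : (h * subst u S * V) ^+ (n.+1 + d') =
      h ^+ d' * subst u S ^+ (n + d') * V * (h ^+ n.+1 * subst u S * V ^+ (n + d')).
      by rewrite !exprMn exprD !addSn !exprS; ring.
    exact: ideal_congr_refl.
  by apply: rad_colon_mull => //; exists e.
have Q1 : Q (h * subst u S * V1).
  by apply: pull; exact: (chart_kill hJ swap_var swap_idx linJ L_homog b j0 syz_gen S_homog hl1 hl2
    l12 l22 (nz _ _ l11) hA hB FE c1E c2E G_homog G_van).
(* The same chart with l1 and l2 exchanged and q1 in place of q2. *)
have Q2 : Q (h * subst u S * V2).
  have FE' j : F j = B j * l2 + A j * l1 by rewrite FE addrC.
  by apply: pull; exact: (chart_kill hJ swap_var swap_idx linJ L_homog b j0 syz_gen S_homog hl2 hl1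
    l21 l11 (nz _ _ l22) hB hA FE' c2E c1E G_homog G_van).
apply: (@rad_colon_exp _ _ _ 2); apply: (@rad_colon_congr _ _ hJ _ _
  (subst u (A j0) * (h * subst u S * V1) + subst u (B j0) * (h * subst u S * V2))).
  have := chart_S hJ swap_idx linJ L_homog b j0 syz_gen S_homog hA hB FE c1E c2E j0.
  move=> /(ideal_congr_mull hJ (h * subst u S)); congr J; rewrite -/u -/V1 -/V2 -/h.
  by rewrite expr2; ring.
by apply: rad_colon_add => //; apply: rad_colon_mull.
Qed.

(** The separators span w_b^(d-1), whose value at u is h^(d-1); so h^d is a combination of the h
    S(u). *)
Lemma rad_chart : Q h.
Proof.
have [S [S_homog Sval Sspan]] := separators rkP.
have [c hc] := Sspan _ (Xn_homog k b d').
have E : subst u ('X_b ^+ d') = h ^+ d' by rewrite rmorphXn /= substXU /u -exprSr.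
apply: (@rad_colon_exp _ _ _ d); rewrite exprS -E hc [subst u _]raddf_sum mulr_sumr.
apply: rad_colon_sum => // a /=.
rewrite comp_mpolyZ -mul_mpolyC mulrCA; apply: rad_colon_mull => //.
by apply: (rad_chart_separator (a := a)).
Qed.

End FixedChart.

(** Induction on n - m_b. If m = w_b w_c m' with c different from b, then x_m^2 is congruent to the
    product of the coordinates of w_c^2 m' and w_b^2 m', and the latter has a larger exponent of
    w_b. *)
Lemma rad_coord_mon j b w (m : 'X_{1..3}) : (n - m b <= w)%N -> mdeg m = n -> m b != 0%N ->
  Q (xf 'X_[m] j).
Proof.
elim: w m => [|w IH] m hw hm mb.
  have mE : m = (U_(b) *+ n)%MM.
    have hb : (n <= m b)%N by rewrite -subn_eq0 -leqn0.
    have h0 i : i != b -> m i = 0%N.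
      move=> ib; have := hm; rewrite mdegE (bigD1 b) //= (bigD1 i) //=.
      by move: (\big[_/_]_(_ | _) _) => X; lia.
    apply/mnmP => i; rewrite mulmnE mnm1E eq_sym.
    case: eqVneq => [->|/h0 -> //]; rewrite mul1n.
    by have := hm; rewrite mdegE (bigD1 b) //= big1 ?addn0.
  by rewrite mE -mpolyXn; apply: rad_chart.
have [hc|] := boolP [forall c, (c != b) ==> (m c == 0%N)].
  apply: IH => //; suff -> : m b = n by rewrite subnn.
  rewrite -hm mdegE (bigD1 b) //= big1 ?addn0 // => i ib.
  by apply/eqP; apply: (implyP (forallP hc i)).
rewrite negb_forall => /existsP[c]; rewrite negb_imply => /andP[cb mc].
have [m' mE] : exists m', m = (U_(b) + (U_(c) + m'))%MM.
  exists (m - U_(b) - U_(c))%MM; rewrite [(U_(c) + _)%MM]addmC submK.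
    by rewrite addmC submK // lep1mP.
  by rewrite lep1mP mnmBE mnm1E [b == _]eq_sym (negbTE cb) subn0.
have hm' : (mdeg m').+1 = n' by move: hm; rewrite mE !mdegD !mdeg1; lia.
have hg c' : 'X_c' * 'X_[m'] \is [in k[3], n'.-homog].
  by rewrite -hm'; apply: (@dhomogM _ _ _ 1 _ (mdeg m')); rewrite dhomogX /= ?mdeg1.
apply: (@rad_colon_exp _ _ _ 2); apply: (@rad_colon_congr _ _ hJ _ _
  (xf ('X_c * ('X_c * 'X_[m'])) j * xf ('X_b * ('X_b * 'X_[m'])) j)).
  have := swap_var b c j j (hg c) (hg b); congr J; rewrite expr2 mE !mpolyXD.
  by rewrite ['X_c * ('X_b * _)]mulrCA.
apply: rad_colon_mull => //; rewrite -!mpolyXD; apply: IH.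
- by move: hw; rewrite mE !mnmDE !mnm1E eqxx (negbTE cb); lia.
- by rewrite !mdegD !mdeg1; lia.
by rewrite mnmDE mnm1E eqxx.
Qed.

Lemma rad_coord s : Q 'X_s.
Proof.
case/mxvec_indexP: s => i j; rewrite -xf_lexmon lexmonE.
have hm := lexmnm_deg (ltn_ord i).
have [b hb] : exists b, lexmnm n i b != 0%N.
  apply/existsP; rewrite -negb_forall; apply/negP => /forallP h0.
  by move: hm; rewrite mdegE big1 // => b _; apply/eqP.
exact: (rad_coord_mon (b := b) j (leqnn _)).
Qed.

End Cover.

(** * Generators and saturation *)

Section Generators.
Variables (k : fieldType) (n' d' : nat).
Local Notation R := {mpoly k[3]}.
Local Notation n := n'.+1.
Local Notation d := d'.+1.
Local Notation M := ('C(n.+2, 2) * d.+1)%N.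
Local Notation xf := (@xf k n d).
Variables (L : 'I_d -> 'I_d.+1 -> R).
Hypothesis L_homog : forall i j, L i j \is 1.-homog.

Definition lin_gen (s : 'I_('C(n'.+2, 2) * d)) : {mpoly k[M]} :=
  mxvec (\matrix_(i < 'C(n'.+2, 2), l < d) \sum_j xf (lexmon k n' i * L l j) j) 0 s.

Definition box_dim (l : 'I_3) : nat := nth 0%N [:: 3; 'C(n'.+2, 2); d.+1] l.

(* Coarser than the paper's 3 x ... x 3 x (d + 1) box: the n - 1 last variables of a monomial
   are grouped into one index, which yields the same ideal. *)
Definition box (f : 'I_3 -> nat) : {mpoly k[M]} :=
  xf ('X_(inord (f 0) : 'I_3) * lexmon k n' (f 1)) (inord (f 2)).

Definition blowup_gens (g : {mpoly k[M]}) :=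
  (exists s, g = lin_gen s) \/ is_box_minor box_dim box g.

Local Notation J := (in_ideal blowup_gens).

Let hJ : is_ideal J := in_ideal_is_ideal _.

Lemma mulX_homog (b : 'I_3) (g : R) e : g \is e.-homog -> 'X_b * g \is e.+1.-homog.
Proof. by move=> hg; apply: (@dhomogM _ _ _ 1 _ e); rewrite ?dhomogX /= ?mdeg1. Qed.

Lemma lin_gen_homog s : lin_gen s \is 1.-homog.
Proof.
case/mxvec_indexP: s => i l; rewrite /lin_gen mxvecE mxE.
by apply: rpred_sum => j _; apply: xf_homog.
Qed.

(** A linear relation gives forms C_l of degree n - 1 with all sums of C_l L_lj over l equal to 0;
    freeness of [L] makes the C_l vanish. *)
Lemma lin_gen_free (L_free : forall c : 'I_d -> R,
    (forall j, \sum_i c i * L i j = 0) -> forall i, c i = 0)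
    (c : 'I_('C(n'.+2, 2) * d) -> k) :
  \sum_s c s *: lin_gen s = 0 -> forall s, c s = 0.
Proof.
pose C l := \sum_(i < 'C(n'.+2, 2)) c (mxvec_index i l) *: lexmon k n' i.
have -> : \sum_s c s *: lin_gen s = \sum_j xf (\sum_l C l * L l j) j.
  rewrite (reindex _ (curry_mxvec_bij _ _)) /=.
  rewrite (eq_bigr (fun p => \sum_j c (mxvec_index p.1 p.2) *: xf (lexmon k n' p.1 * L p.2 j) j));
    last by case=> i l _; rewrite /= /lin_gen mxvecE mxE scaler_sumr.
  rewrite -(pair_bigA _ (fun i l => \sum_j c (mxvec_index i l) *: xf (lexmon k n' i * L l j) j)) /=.
  rewrite exchange_big /=.
  under eq_bigr do rewrite exchange_big /=.
  rewrite exchange_big /=; apply: eq_bigr => j _; rewrite xf_sum; apply: eq_bigr => l _.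
  rewrite /C mulr_suml xf_sum; apply: eq_bigr => i _.
  by rewrite -scalerAl xfZ.
move/xf_free => h s; have {}h : forall l, C l = 0.
  apply: L_free => j; apply: h => {}j; apply: rpred_sum => l _.
  rewrite -[n]addn1; apply: dhomogM; rewrite ?L_homog //.
  by apply: rpred_sum => i _; apply: rpredZ; apply: lexmon_homog.
case/mxvec_indexP: s => i l.
exact: (lexmon_free (h l) i).
Qed.

Definition box_idx (b i j : nat) (l : 'I_3) : nat := nth 0%N [:: b; i; j] l.

Lemma box_idxE (b : 'I_3) (i : nat) (j : 'I_d.+1) :
  box (box_idx b i j) = xf ('X_b * lexmon k n' i) j.
Proof. by rewrite /box /box_idx /= !inord_val. Qed.

Lemma in_box_idx (b : 'I_3) (i : 'I_('C(n'.+2, 2))) (j : 'I_d.+1) :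
  in_box box_dim (box_idx b i j).
Proof. by apply: ord3P; rewrite /box_dim /box_idx /= ltn_ord. Qed.

(** By bilinearity it suffices to take monomials g, g', where the expression is a box minor in
    direction 0. *)
Lemma swap_var_gens b b' (g g' : R) j j' : g \is n'.-homog -> g' \is n'.-homog ->
  J (xf ('X_b * g) j * xf ('X_b' * g') j' - xf ('X_b' * g) j * xf ('X_b * g') j').
Proof.
move=> hg hg'; move: g hg; apply: homog_ind.
- by rewrite !mulr0 !xf0 !mul0r subr0; case: hJ.
- move=> g1 g2 h1 h2; rewrite !mulrDr !xfD !mulrDl opprD addrACA.
  by case: hJ => _ hD _; apply: hD.
move=> c i; move: g' hg'; apply: homog_ind.
- by rewrite !mulr0 !xf0 !mulr0 subr0; case: hJ.
- move=> g1 g2 h1 h2; rewrite !mulrDr !xfD !mulrDr opprD addrACA.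
  by case: hJ => _ hD _; apply: hD.
move=> c' i'; rewrite -!scalerAr !xfZ -!scalerAl -!scalerAr -!scalerBr -!mul_mpolyC.
case: hJ => _ _ hM; apply: (hM); apply: (hM); apply: in_ideal_gen; right.
exists 0, (box_idx b i j), (box_idx b' i' j'); do 2![split; first exact: in_box_idx].
by rewrite /box_minor -!box_idxE.
Qed.

Lemma lexmon_split (i : 'I_('C(n.+2, 2))) : exists (b : 'I_3) (i' : 'I_('C(n'.+2, 2))),
  lexmon k n i = 'X_b * lexmon k n' i'.
Proof.
have hm := lexmnm_deg (ltn_ord i).
have [b hb] : exists b, lexmnm n i b != 0%N.
  apply/existsP; rewrite -negb_forall; apply/negP => /forallP h0.
  by move: hm; rewrite mdegE big1 // => b _; apply/eqP.
have mE : lexmnm n i = (U_(b) + (lexmnm n i - U_(b)))%MM by rewrite addmC submK // lep1mP.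
have /lexmnm_surj[i' hi'] : mdeg (lexmnm n i - U_(b))%MM = n'.
  by move: hm; rewrite {1}mE mdegD mdeg1 => -[].
by exists b, i'; rewrite !lexmonE hi' -mpolyXD -mE.
Qed.

(** By bilinearity and [lexmon_split] this reduces to box minors in direction 2. *)
Lemma swap_idx_gens (g g' : R) j j' : g \is n.-homog -> g' \is n.-homog ->
  J (xf g j * xf g' j' - xf g j' * xf g' j).
Proof.
move=> hg hg'; move: g hg; apply: homog_ind.
- by rewrite !xf0 !mul0r subr0; case: hJ.
- move=> g1 g2 h1 h2; rewrite !xfD !mulrDl opprD addrACA.
  by case: hJ => _ hD _; apply: hD.
move=> c i; move: g' hg'; apply: homog_ind.
- by rewrite !xf0 !mulr0 subr0; case: hJ.
- move=> g1 g2 h1 h2; rewrite !xfD !mulrDr opprD addrACA.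
  by case: hJ => _ hD _; apply: hD.
move=> c' i'; rewrite !xfZ -!scalerAl -!scalerAr -!scalerBr -!mul_mpolyC.
case: hJ => _ _ hM; apply: (hM); apply: (hM); apply: in_ideal_gen; right.
have [b [l ->]] := lexmon_split i; have [b' [l' ->]] := lexmon_split i'.
exists 2, (box_idx b l j), (box_idx b' l' j'); do 2![split; first exact: in_box_idx].
by rewrite /box_minor -!box_idxE.
Qed.

Lemma lin_gens i (g : R) : g \is n'.-homog -> J (\sum_j xf (g * L i j) j).
Proof.
move: g; apply: homog_ind.
- by rewrite big1 => [|j _]; [case: hJ|rewrite mul0r xf0].
- move=> g1 g2 h1 h2; under eq_bigr do rewrite mulrDl xfD.
  by rewrite big_split; case: hJ => _ hD _; apply: hD.
move=> c l; under eq_bigr do rewrite -scalerAl xfZ.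
rewrite -scaler_sumr -mul_mpolyC; case: hJ => _ _; apply; apply: in_ideal_gen; left.
by exists (mxvec_index l i); rewrite /lin_gen mxvecE mxE.
Qed.

(** On the image, a linear generator becomes a multiple of a syzygy of [F], and a box entry becomes
    a product of three factors, each depending on one index, so the minors vanish. *)
Lemma gens_closure (F : 'I_d.+1 -> R) : (forall i, \sum_j L i j * F j = 0) ->
  forall G, J G -> closure_ideal n F G.
Proof.
move=> LF _ [cs [hcs ->]] w; rewrite raddf_sum big_seq big1 // => c /hcs hc /=.
rewrite rmorphM /=; suff -> : (c.2).@[phi n F w] = 0 by rewrite mulr0.
case: hc => [[s ->]|[l [i [j [hi [hj ->]]]]]].
  case/mxvec_indexP: s => i l; rewrite /lin_gen mxvecE mxE raddf_sum /=.
  have hz j : lexmon k n' i * L l j \is n.-homog.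
    by rewrite mulrC; apply: (@dhomogM _ _ _ 1 _ n'); rewrite ?L_homog ?lexmon_homog.
  under eq_bigr do rewrite meval_xf // rmorphM /= -mulrA.
  rewrite -mulr_sumr; have := congr1 (meval w) (LF l); rewrite meval0 raddf_sum /=.
  by under eq_bigr do rewrite rmorphM /=; move=> ->; rewrite mulr0.
have boxE (f : 'I_3 -> nat) : (f 1%R < 'C(n'.+2, 2))%N -> (box f).@[phi n F w] =
    w (inord (f 0)) * (lexmon k n' (f 1)).@[w] * (F (inord (f 2))).@[w].
  move=> hf; rewrite meval_xf; last exact: mulX_homog (lexmon_homog k (Ordinal hf)).
  by rewrite rmorphM /= mevalXU.
have hi1 : (i 1%R < 'C(n'.+2, 2))%N := hi 1.
have hj1 : (j 1%R < 'C(n'.+2, 2))%N := hj 1.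
rewrite /box_minor mevalB !rmorphM /= !boxE //; last 2 first.
- by rewrite /swap_coord; case: ifP => [/eqP <-|].
- by rewrite /swap_coord; case: ifP => [/eqP <-|].
by move: l; apply: ord3P; rewrite /swap_coord /=; ring.
Qed.

End Generators.

(** * Homogeneous components, saturation and the final assembly *)

Lemma zF_meval (k : fieldType) n' d' (F : 'I_d'.+2 -> {mpoly k[3]}) w s :
  (zF (n' := n') F s).@[w] = phi n'.+1 F w s.
Proof. by case/mxvec_indexP: s => i j; rewrite /zF /phi !mxvecE !mxE. Qed.

Lemma zF_homog (k : fieldType) n' d' (F : 'I_d'.+2 -> {mpoly k[3]}) s :
  (forall j, F j \is (d'.+1).-homog) -> zF (n' := n') F s \is (n'.+1 + d'.+1).-homog.
Proof.
by move=> hF; case/mxvec_indexP: s => i j; rewrite /zF mxvecE mxE dhomogM ?lexmon_homog.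
Qed.

(** The substitution multiplies degrees by D > 0, so distinct components of G have images in
    distinct degrees and cannot cancel. *)
Lemma subst_pihomog (k : fieldType) M D (t : 'I_M -> {mpoly k[3]}) (G : {mpoly k[M]}) :
  (0 < D)%N -> (forall s, t s \is D.-homog) -> subst t G = 0 ->
  forall e, subst t (pihomog mdeg e G) = 0.
Proof.
move=> D0 ht G0 e; pose b := (msize G + e.+1)%N.
have GE : G = \sum_(i < b) pihomog mdeg i G by apply: pihomog_partitionE; apply: leq_addr.
have := congr1 (pihomog mdeg (D * e)) G0.
rewrite raddf0 {1}GE [subst t _]raddf_sum raddf_sum /=.
have he : (e < b)%N by rewrite /b; lia.
rewrite (bigD1 (Ordinal he)) //= pihomog_dE; last by apply: subst_homog => //; apply: pihomogP.
rewrite big1 ?addr0 // => i ne; apply: (@pihomog_ne0 _ _ _ (D * i)%N).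
  by rewrite eqn_pmul2l.
by apply: subst_homog => //; apply: pihomogP.
Qed.

Lemma saturation_of_coords (k : fieldType) M (J : {mpoly k[M]} -> Prop) (G : {mpoly k[M]}) :
  is_ideal J -> (forall e s, rad_colon J (pihomog mdeg e G) 'X_s) ->
  exists N, forall a : 'X_{1..M}, mdeg a = N -> J ('X_[a] * G).
Proof.
move=> hJ h.
have [N hN] : exists N, forall s, J ('X_s ^+ N * G).
  have [f hf] := fin_all_exists (fun e : 'I_(msize G) => fin_all_exists (h e)).
  (* The sum of all exponents bounds each of them, whatever the component and the coordinate. *)
  exists (\sum_e \sum_s f e s)%N => s.
  rewrite [X in _ * X](pihomog_partitionE (mf := mdeg) (leqnn _) : G = _) mulr_sumr.
  apply: ideal_sum => // e _.
  have /subnK <- : (f e s <= \sum_e \sum_s f e s)%N.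
    by rewrite (bigD1 e) //= (bigD1 s) //= -addnA leq_addr.
  by rewrite exprD -mulrA; case: hJ => _ _; apply.
(* Pigeonhole: a monomial in M variables of degree above M N has an exponent at least N. *)
exists (M * N).+1 => a ha.
have [s hs] : exists s, (N <= a s)%N.
  apply/existsP; apply: contraT; rewrite negb_exists => /forallP hlt.
  suff : (mdeg a <= M * N)%N by rewrite ha ltnn.
  rewrite mdegE -[X in (_ <= X * _)%N]card_ord -sum_nat_const; apply: leq_sum => s _.
  by rewrite ltnW // ltnNge.
have -> : a = (a - U_(s) *+ N + U_(s) *+ N)%MM.
  rewrite submK //; apply/mnm_lepP => i; rewrite mulmnE mnm1E.
  by case: eqP => [<-|_]; rewrite ?mul1n ?mul0n.
by rewrite mpolyXD -mpolyXn -mulrA; case: hJ => _ _; apply.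
Qed.

Theorem theorem2p6 (k : closedFieldType) (hchar : [pchar k] =i pred0)
  (d n : nat) (hd : (1 <= d)%N) (hn : (1 <= n)%N)
  (P : 'I_('C(d.+1, 2)) -> 'rV[k]_3)
  (hdist : distinct_proj_points P) (hgen : generic_position P)
  (F : 'I_d.+1 -> {mpoly k[3]})
  (hFhom : forall j, F j \is d.-homog)
  (hFvan : forall j a, (F j).@[coords (P a)] = 0)
  (hFind : forall c : 'I_d.+1 -> k, \sum_j c j *: F j = 0 -> forall j, c j = 0) :
  exists (lin : 'I_('C(n.+1, 2) * d) -> {mpoly k[('C(n.+2, 2) * d.+1)]})
         (m : nat) (r : 'I_m -> nat)
         (A : ('I_m -> nat) -> {mpoly k[('C(n.+2, 2) * d.+1)]}),
    [/\ forall s, lin s \is 1.-homog,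
        (forall c : 'I_('C(n.+1, 2) * d) -> k,
            \sum_s c s *: lin s = 0 -> forall s, c s = 0),
        (forall i, in_box r i -> A i \is 1.-homog) &
        defines_subscheme
          (fun g => (exists s, g = lin s) \/ is_box_minor r A g)
          (closure_ideal n F)].
Proof.
case: d hd P hdist hgen F hFhom hFvan hFind => // d' _ P [P_neq0 _] hgen F hFhom hFvan hFind.
case: n hn => // n' _.
(* X has as many points as there are monomials of degree d - 1, so both terms of the minimum
   agree. *)
have rkP : hilb_fun P d' = 'C(d'.+2, 2) by rewrite hgen minnn.
have [L [L_homog LF L_gen L_free]] :=
  hilbert_burch hchar P_neq0 (generic_no_form rkP) hFhom hFvan hFind.
exists (lin_gen (n' := n') L), 3, (box_dim n' d'), (@box k n' d'); split.
- by move=> s; apply: lin_gen_homog.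
- exact: lin_gen_free.
- by move=> i _; apply: xf_homog.
split; first exact: gens_closure.
move=> G hG; apply: saturation_of_coords; first exact: in_ideal_is_ideal.
(* A polynomial vanishing at all points is 0 in characteristic 0. *)
have G0 : subst (zF (n' := n') F) G = 0.
  apply: (meval_eq0 hchar) => w; rewrite meval_subst -[RHS](hG w).
  by apply: meval_eq => s; apply: zF_meval.
move=> e s; apply: (rad_coord hchar (in_ideal_is_ideal _) (@swap_var_gens k n' d' L)
  (@swap_idx_gens k n' d' L) (@lin_gens k n' d' L) L_homog L_gen P_neq0 rkP hFhom hFvan hFind
  (pihomogP mdeg e G)).
by apply: (subst_pihomog _ (fun s => zF_homog s hFhom)).
Qed.
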